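(* Let $Y$ be a proper geodesic metric space of bounded geometry with $\operatorname{asdim}Y=2$ and $\operatorname{asdim}(Y\times\mathbb R)=2$. Then the coarse cohomological dimension of $Y$ is $\operatorname{X-dim}Y=1$.
   Context: Proper: closed balls are compact. Bounded geometry: for every $R$ the maximal cardinality of 1-separated subsets of $R$-balls is uniformly bounded. $\operatorname{asdim}X\le n$ if for every $d>0$ there are $R$ and $n+1$ $d$-disjoint, $R$-bounded families of subsets of $X$ whose union covers $X$ ($d$-disjoint: $d(x,y)>d$ for points $x,y$ of distinct members; $R$-bounded: diameters $\le R$). $Y\times\mathbb R$ has a product metric (e.g. $\ell_1$). Anti-Čech approximation of a metric space $Y$: a sequence of uniformly bounded, locally finite, irreducible open covers $\mathcal U_1\prec\mathcal U_2\prec\cdots$ of $Y$ ($\mathcal U_i$ refines $\mathcal U_{i+1}$; irreducible: no proper subfamily obtained by deleting one member is a cover) whose Lebesgue numbers $L(\mathcal U_i)=\inf_{x}\sup_{U\in\mathcal U_i}d(x,Y\setminus U)$ tend to infinity. Let $N_i$ be the nerve of $\mathcal U_i$, $q^i_{i+1}:N_i\to N_{i+1}$ simplicial refinement maps, and $p_i:Y\to N_i$ the projection to the nerve given by a partition of unity $\{\phi_U\}$ with $\phi_U^{-1}(0)=Y\setminus U$. Spaces of bounded geometry admit anti-Čech approximations. Coarse cohomology (Roe): $HX^*(Y)$ is the cohomology of the inverse limit of the complexes $C_0^*(N_i)$ of compactly supported integral simplicial cochains. For $A\subset Y$ let $A_i=\operatorname{St}(p_i(A),N_i)$ be the union of the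 simplices of $N_i$ meeting $p_i(A)$ (one may assume $q^i_{i+1}(A_i)\subset A_{i+1}$); $HX^*(Y,A)$ is defined in the same way by compactly supported cochains vanishing on $A_i$, so that there is an exact sequence $0\to\varprojlim^1H_c^{k-1}(N_i\setminus A_i)\to HX^k(Y,A)\to\varprojlim H_c^k(N_i\setminus A_i)\to0$. Coarse cohomological dimension (integral coefficients): $\operatorname{X-dim}Y=\max\{k\mid HX^k(Y,A)\ne0\text{ for some }A\subset Y\}-1$.
   Formalization: Coarse cohomology is taken as the cohomology of the derived inverse limit (mapping telescope), as the lim^1 exact sequence requires (the plain inverse limit can vanish), for any anti-Čech approximation with q(A_i) ⊂ A_{i+1} for all A at once. *)

(* Defs.v *)
From HB Require Import structures.
From mathcomp Require Import all_boot all_order all_algebra perm.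
From mathcomp Require Import finmap.
From mathcomp Require Import all_classical all_reals all_analysis.

Set Implicit Arguments.
Unset Strict Implicit.
Unset Printing Implicit Defensive.

Import Order.TTheory GRing.Theory Num.Theory.
Import numFieldNormedType.Exports.

Local Open Scope classical_set_scope.
Local Open Scope ring_scope.

Definition proper_space (R : realType) (Y : metricType R) : Prop :=
  forall (x : Y) (r : R), compact [set y | mdist x y <= r].

Definition geodesic_space (R : realType) (Y : metricType R) : Prop :=
  forall x y : Y, exists g : R -> Y,
    [/\ g 0 = x, g (mdist x y) = y &
        forall s t, 0 <= s <= mdist x y -> 0 <= t <= mdist x y ->
          mdist (g s) (g t) = `|s - t|].

Definition bounded_geometry (R : realType) (Y : metricType R) : Prop :=
  forall r : R, exists N : nat, forall (x : Y) (S : set Y),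
    S `<=` [set y | mdist x y <= r] ->
    (forall a b, S a -> S b -> a <> b -> 1 <= mdist a b) ->
    (S #<= `I_N)%card.

(* Asymptotic dimension depends only on the distance function, so it is defined
   for a bare distance; it can then be applied to [mdist] and to the l1 distance
   on a product. *)

Section Asdim.
Context {R : realType} {T : Type}.
Implicit Types (dist : T -> T -> R) (F : set (set T)).

Definition diam_le dist (r : R) (A : set T) : Prop :=
  forall x y, A x -> A y -> dist x y <= r.

Definition disjoint_family dist (r : R) F : Prop :=
  forall A B, F A -> F B -> A <> B -> forall x y, A x -> B y -> r < dist x y.

Definition asdim_le dist (n : nat) : Prop :=
  forall r : R, 0 < r -> exists (D : R) (F : 'I_n.+1 -> set (set T)),
    [/\ forall j, disjoint_family dist r (F j),
        forall j A, F j A -> diam_le dist D A &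
        forall x, exists j A, F j A /\ A x].

Definition is_asdim dist (n : nat) : Prop :=
  asdim_le dist n /\ forall m, asdim_le dist m -> (n <= m)%N.

End Asdim.

Definition l1_dist (R : realType) (Y : metricType R) (p q : Y * R) : R :=
  mdist p.1 q.1 + `|p.2 - q.2|.

Section SimplicialCochains.
Context {V : choiceType}.

(* A simplicial complex, as the set of its (nonempty) simplices. *)
Implicit Types K L : set {fset V}.

Definition vset n (v : 'I_n -> V) : {fset V} := [fset v i | i in 'I_n]%fset.

(* Simplices are indexed here by their number of vertices: [cochain n] holds
   cochains of degree n - 1. As the empty set is not a simplex, [ccochains K L 0]
   is the zero group, which plays the role of the cochains of degree -1. *)
Definition cochain (n : nat) := ('I_n -> V) -> int.

(* Oriented (alternating) cochains on K with compact support, vanishing on L. *)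
Definition ccochains K L n : set (cochain n) :=
  [set f | [/\ forall v, f v <> 0 ->
                 [/\ injective v, K (vset v) & ~ L (vset v)],
               forall v (s : 'S_n), f (v \o s) = (-1) ^+ s * f v &
               finite_set [set v | f v <> 0]]].

Definition coboundary K n (f : cochain n) : cochain n.+1 :=
  fun v => if `[< K (vset v) >]
           then \sum_(i < n.+1) (-1) ^+ i * f (v \o lift i) else 0.

Definition pullback K (q : V -> V) n (f : cochain n) : cochain n :=
  fun v => if `[< K (vset v) >] then f (q \o v) else 0.

(* The closed geometric simplex spanned by s, in barycentric coordinates. *)
Definition geom_simplex (R : realType) (s : {fset V}) : set (V -> R) :=
  [set t | [/\ forall u, 0 <= t u, forall u, u \notin s -> t u = 0 &
               \sum_(u <- s) t u = 1]].

(* The subcomplex St(P, K): the union of the simplices of K meeting P. *)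
Definition star (R : realType) (P : set (V -> R)) K : set {fset V} :=
  [set s | K s /\ exists s', [/\ K s', (s `<=` s')%fset &
                                 geom_simplex s' `&` P !=set0]].

End SimplicialCochains.

Arguments cochain : clear implicits.

Definition nerve (T : Type) (U : set (set T)) : set {fset set T} :=
  [set s | [/\ s != fset0, forall u, u \in s -> U u &
               exists y, forall u, u \in s -> u y]].

Definition nerve_proj (R : realType) (T : Type) (U : set (set T))
    (phi : set T -> T -> R) (y : T) : set T -> R :=
  fun u => if u \in U then phi u y else 0.

Section Covers.
Context {R : realType} {Y : metricType R}.
Implicit Types U : set (set Y).

Definition covers U : Prop := \bigcup_(u in U) u = setT.

Definition irreducible_cover U : Prop :=
  covers U /\ forall u, U u -> ~ covers (U `\ u).

Definition uniformly_bounded U : Prop :=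
  exists D : R, forall u, U u -> diam_le mdist D u.

Definition locally_finite_family U : Prop :=
  forall x : Y, exists2 O, nbhs x O & finite_set [set u | U u /\ u `&` O !=set0].

Definition Lebesgue_number U : \bar R :=
  ereal_inf [set ereal_sup [set edist_inf (~` u) x | u in U] | x in [set: Y]].

Definition partition_of_unity U (phi : set Y -> Y -> R) : Prop :=
  [/\ forall u, U u -> continuous (phi u),
      forall u y, U u -> 0 <= phi u y,
      forall u, U u -> phi u @^-1` [set 0] = ~` u &
      forall y, \sum_(u \in U) phi u y = 1].

End Covers.

(* An anti-Cech approximation together with the choices of refinement maps and
   partitions of unity. [acs_star] is the compatibility q(A_i) `<=` A_{i+1}; it is
   required for all A at once, and can be arranged by passing to a subsequence
   of the covers and letting q send u to a member containing every w in the
   i-th cover that meets u. *)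
Record anti_cech_system (R : realType) (Y : metricType R) := AntiCechSystem {
  acs_cover : nat -> set (set Y);
  acs_refine : nat -> set Y -> set Y;
  acs_unity : nat -> set Y -> Y -> R;
  acs_open : forall i u, acs_cover i u -> open u;
  acs_bounded : forall i, uniformly_bounded (acs_cover i);
  acs_locfin : forall i, locally_finite_family (acs_cover i);
  acs_irreducible : forall i, irreducible_cover (acs_cover i);
  acs_refineP : forall i u, acs_cover i u ->
    acs_cover i.+1 (acs_refine i u) /\ u `<=` acs_refine i u;
  acs_Lebesgue : (fun i => Lebesgue_number (acs_cover i)) @ \oo --> +oo%E;
  acs_unityP : forall i, partition_of_unity (acs_cover i) (acs_unity i);
  acs_star : forall (A : set Y) i s,
    star (nerve_proj (acs_cover i) (acs_unity i) @` A) (nerve (acs_cover i)) s ->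
    star (nerve_proj (acs_cover i.+1) (acs_unity i.+1) @` A)
         (nerve (acs_cover i.+1)) [fset acs_refine i u | u in s]%fset }.

(* The refinement maps identify vertices, so C_0^*(N_{i+1}) -> C_0^*(N_i) need
   not be onto, and the degreewise inverse limit of these complexes does not
   compute coarse cohomology (if any two vertices are eventually identified, it
   vanishes on unbounded spaces). The limit has to be the derived one, given by
   the mapping telescope: the fibre of
     prod_i C_0^*(N_i, A_i) -> prod_i C_0^*(N_i, A_i),  (a_i) |-> (q^* a_{i+1} - a_i).
   It is the one that yields the exact sequence
     0 -> lim^1 H_c^{k-1}(N_i \ A_i) -> HX^k(Y, A) -> lim H_c^k(N_i \ A_i) -> 0
   and agrees with the plain limit when the q^* are onto. *)

Section CoarseCohomology.
Context {R : realType} {Y : metricType R} (D : anti_cech_system Y).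

Definition acs_nerve (i : nat) : set {fset set Y} := nerve (acs_cover D i).

Definition acs_sub (A : set Y) (i : nat) : set {fset set Y} :=
  star (nerve_proj (acs_cover D i) (acs_unity D i) @` A) (acs_nerve i).

(* A telescope cochain of degree k: families of cochains of degree k and k - 1. *)
Definition tel (k : nat) : Type :=
  ((nat -> cochain (set Y) k.+1) * (nat -> cochain (set Y) k))%type.

Definition telC (A : set Y) (k : nat) : set (tel k) :=
  [set z | forall i, ccochains (acs_nerve i) (acs_sub A i) (z.1 i) /\
                     ccochains (acs_nerve i) (acs_sub A i) (z.2 i)].

Definition telD (k : nat) (z : tel k) : tel k.+1 :=
  (fun i => coboundary (acs_nerve i) (z.1 i),
   fun i v => pullback (acs_nerve i) (acs_refine D i) (z.1 i.+1) v
              - z.1 i v - coboundary (acs_nerve i) (z.2 i) v).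

Definition tel0 (k : nat) : tel k := (fun _ _ => 0, fun _ _ => 0).

Definition tel_cocycles (A : set Y) (k : nat) : set (tel k) :=
  [set z | telC A z /\ telD z = tel0 k.+1].

Definition tel_coboundaries (A : set Y) (k : nat) : set (tel k) :=
  match k with
  | 0 => [set tel0 0]
  | k'.+1 => [set telD w | w in telC A (k := k')]
  end.

(* HX^k(Y, A), the quotient of the cocycles by the coboundaries, is not 0. *)
Definition HX_neq0 (A : set Y) (k : nat) : Prop :=
  exists z : tel k, tel_cocycles A z /\ ~ tel_coboundaries A z.

(* X-dim Y = d, the degrees k with HX^k(Y, A) <> 0 for some A having a maximum. *)
Definition is_Xdim (d : int) : Prop :=
  exists k : nat,
    [/\ exists A, HX_neq0 A k,
        forall j, (exists A, HX_neq0 A j) -> (j <= k)%N &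
        d = k%:Z - 1].

End CoarseCohomology.

(* Main.v *)
(** Vanishing of HX^k(Y, A), k >= 3. The coloured covers of Y x R given by
    asdim (Y x R) <= 2 send each vertex u of N_i, at each height t, to a coloured
    set, hence to a vertex of N_j with j >> i, and all these maps N_i -> N_j are
    contiguous to the refinement map q. Weight a cocycle z on N_j by the
    indicator that the label of largest colour lies at positive height. Four
    vertices of a simplex have at most three labels, so in degree >= 2 the
    weighted cochain is a cocycle on the complex of labels; it pulls back to a
    representative of q^* z at large positive heights and to 0 at large negative
    ones, and neighbouring heights are contiguous. So q^* kills H_c^m for m >= 2,
    i.e. these towers are pro-zero, and both lim and lim^1 vanish.

    Non-vanishing of HX^2(Y, A). Let A be a sparse sequence (a_i) and let b_i be
    the coboundary of i times the indicator of the star of a_i in N_i. If (0, b)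
    bounded (c, e), then the integral of c_i along the image in N_i of a path
    from a_0 to a_k jumps by k when i passes k and is 0 for large i, so it would
    be -k at the initial stage. But c_i has finite support and a geodesic from
    a_0 meets that support in boundedly many steps. *)

Require Import Defs.
From mathcomp Require Import all_boot all_order all_algebra perm.
From mathcomp Require Import finmap.
From mathcomp Require Import all_classical all_reals all_analysis.
From mathcomp Require Import zify lra.

Set Implicit Arguments.
Unset Strict Implicit.
Unset Printing Implicit Defensive.

Import Order.TTheory GRing.Theory Num.Theory.
Import numFieldNormedType.Exports.

Local Open Scope classical_set_scope.
Local Open Scope ring_scope.

(** * Alternating cochains *)

Section Alternating.
Context {V : choiceType}.

(** The algebraic part of [ccochains], without complex or finiteness: the weighted cochain on labels
    built later is shown to satisfy only this much. *)
Definition alternating n (z : cochain V n) : Prop :=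
  (forall v, ~ injective v -> z v = 0) /\
  (forall v (s : 'S_n), z (v \o s) = (-1) ^+ s * z v).

(** The coboundary formula freed from the membership test, so that it can be evaluated on any
    tuple. *)
Definition face_sum n (z : cochain V n) (v : 'I_n.+1 -> V) : int :=
  \sum_(i < n.+1) (-1) ^+ i * z (v \o lift i).

Definition fcons n (a : V) (v : 'I_n -> V) : 'I_n.+1 -> V :=
  fun i => if unlift ord0 i is Some k then v k else a.

Lemma fcons0 n a (v : 'I_n -> V) : fcons a v ord0 = a.
Proof. by rewrite /fcons unlift_none. Qed.

Lemma fcons_lift n a (v : 'I_n -> V) k : fcons a v (lift ord0 k) = v k.
Proof. by rewrite /fcons liftK. Qed.

Lemma fcons_lift0 n a (v : 'I_n -> V) : fcons a v \o lift ord0 = v.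
Proof. by apply/funext => k /=; rewrite fcons_lift. Qed.

Lemma lift_lift0 n (i : 'I_n.+1) (k : 'I_n) :
  lift (lift ord0 i) (lift ord0 k) = lift ord0 (lift i k).
Proof. by apply: val_inj; rewrite /= /bump !leq0n !add1n ltnS addnS. Qed.

Lemma lift_ord0 n (i : 'I_n.+1) : lift (lift ord0 i) ord0 = ord0.
Proof. by apply: val_inj. Qed.

Lemma fcons_liftS n a (v : 'I_n.+1 -> V) i :
  fcons a v \o lift (lift ord0 i) = fcons a (v \o lift i).
Proof.
apply/funext => k /=; case: (unliftP ord0 k) => [k' ->|->].
  by rewrite lift_lift0 !fcons_lift.
by rewrite lift_ord0 !fcons0.
Qed.

Lemma face_sum_fcons n (z : cochain V n.+1) a v :
  face_sum z (fcons a v) = z v - \sum_(i < n.+1) (-1) ^+ i * z (fcons a (v \o lift i)).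
Proof.
rewrite /face_sum big_ord_recl /= expr0 mul1r fcons_lift0; congr (_ + _).
rewrite -sumrN; apply: eq_bigr => i _.
by rewrite fcons_liftS /bump leq0n add1n exprS mulN1r mulNr.
Qed.

Lemma perm_lift n (s : 'S_n.+1) (i : 'I_n.+1) :
  exists t : 'S_n, s = lift_perm i (s i) t.
Proof.
have H k : exists k', s (lift i k) = lift (s i) k'.
  case: (unliftP (s i) (s (lift i k))) => [k' ->|/perm_inj /eqP]; first by exists k'.
  by rewrite eq_sym (negPf (neq_lift i k)).
pose t k := projT1 (cid (H k)).
have tE k : s (lift i k) = lift (s i) (t k) by rewrite /t; case: cid.
have tinj : injective t.
  move=> k k' e; apply: (@lift_inj _ i); apply: (@perm_inj _ s).
  by rewrite !tE e.
exists (perm tinj); apply/permP => j.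
case: (unliftP i j) => [k ->|->]; last by rewrite lift_perm_id.
by rewrite lift_perm_lift permE tE.
Qed.

(** If [v a = v b], every face keeping both [a] and [b] has a repeated vertex. Only the faces
    omitting [a] or [b] remain; they agree up to a permutation and cancel. *)
Lemma face_sum_noninj n (z : cochain V n) v :
  alternating z -> ~ injective v -> face_sum z v = 0.
Proof.
move=> [z0 zs] vni.
have [a [b [ab eab]]] : exists a b, a <> b /\ v a = v b.
  apply: contrapT => H; apply: vni => a b e; apply: contrapT => ab.
  by apply: H; exists a, b.
have ba : b != a by apply/eqP => e; apply: ab.
rewrite /face_sum (bigD1 a) //= (bigD1 b) //= big1 => [|i /andP[ia ib]]; last first.
  rewrite z0 ?mulr0 // => inj.
  have [[a' Ha] [b' Hb]] : (exists a', a = lift i a') /\ (exists b', b = lift i b').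
    split.
      by case: (unliftP i a) => [k ->|e]; [exists k|rewrite e eqxx in ia].
    by case: (unliftP i b) => [k ->|e]; [exists k|rewrite e eqxx in ib].
  have /inj e : (v \o lift i) a' = (v \o lift i) b' by rewrite /= -Ha -Hb.
  by apply: ab; rewrite Ha Hb e.
have [s Hs] := perm_lift (tperm a b) b; have Hb := tpermR a b.
have vt : v \o tperm a b = v.
  apply/funext => i /=; case: tpermP => // ->; by rewrite eab.
have vb : v \o lift b = (v \o lift a) \o s.
  apply/funext => k /=; rewrite -{1}vt /= {1}Hs lift_perm_lift tpermR //.
(* [s] is the transposition of [a] and [b] restricted to the indices other than [b]; its parity
   makes the two remaining signs opposite. *)
have odds : odd b (+) odd a (+) s = true.
  by rewrite -odd_lift_perm -[X in lift_perm _ X]Hb -Hs odd_tperm eq_sym ba.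
rewrite addr0 vb zs mulrA -mulrDl.
suff -> : (-1) ^+ a + (-1) ^+ b * (-1) ^+ s = 0 :> int by rewrite mul0r.
rewrite -(signr_odd _ a) -(signr_odd _ b) -signr_addb.
have -> : odd b (+) s = ~~ odd a.
  by move: odds; case: (odd a); case: (odd b); case: (odd_perm s).
by rewrite signrN subrr.
Qed.

Lemma alternating_fcons n (z : cochain V n.+1) a :
  alternating z -> alternating (fun v : 'I_n -> V => z (fcons a v)).
Proof.
move=> [z0 zs]; split=> [v vni|v s].
  apply: z0 => inj; apply: vni => i j e; apply: (@lift_inj _ ord0).
  by apply: inj; rewrite !fcons_lift.
have -> : fcons a (v \o s) = fcons a v \o lift_perm ord0 ord0 s.
  apply/funext => i /=; case: (unliftP ord0 i) => [k ->|->].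
    by rewrite lift_perm_lift !fcons_lift.
  by rewrite lift_perm_id !fcons0.
by rewrite zs odd_lift_perm.
Qed.

(** Bringing vertex [i] to the front is a cycle of sign (-1)^i. *)
Lemma alternating_move n (z : cochain V n.+1) (v : 'I_n.+1 -> V) (i : 'I_n.+1) :
  alternating z -> (-1) ^+ i * z (fcons (v i) (v \o lift i)) = z v.
Proof.
move=> [_ zs].
have -> : fcons (v i) (v \o lift i) = v \o lift_perm ord0 i 1%g.
  apply/funext => j /=; case: (unliftP ord0 j) => [k ->|->].
    by rewrite lift_perm_lift fcons_lift perm1.
  by rewrite lift_perm_id fcons0.
rewrite zs odd_lift_perm odd_perm1 addbF signr_odd mulrA -expr2.
by rewrite sqrr_sign mul1r.
Qed.

Lemma coboundaryE K n (z : cochain V n) v :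
  coboundary K z v = if `[< K (vset v) >] then face_sum z v else 0.
Proof. by []. Qed.

Lemma vset_perm n (v : 'I_n -> V) (s : 'S_n) : vset (v \o s) = vset v.
Proof.
apply/fsetP => x; apply/imfsetP/imfsetP => /= -[k _ ->].
  by exists (s k).
by exists ((s^-1)%g k) => //=; rewrite permKV.
Qed.

Lemma vsetP n (v : 'I_n -> V) x : reflect (exists k, x = v k) (x \in vset v).
Proof.
rewrite /vset; apply: (iffP (imfsetP _ _ _ _)) => /= [[k _ ->]|[k ->]].
  by exists k.
by exists k.
Qed.

End Alternating.

(** * Homotopies of contiguous maps *)

Section CochainGroups.
Context {V : choiceType} (K L : set {fset V}).

Definition face_closed : Prop :=
  forall s t : {fset V}, K s -> t != fset0 -> (t `<=` s)%fset -> K t.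

Lemma alternating_ccochains n (z : cochain V n) :
  ccochains K L z -> alternating z.
Proof.
move=> [h1 h2 _]; split=> // v vni; apply: contrapT => /h1 [vi _ _]; exact: vni.
Qed.

Lemma ccochains0 n : ccochains K L (fun _ : 'I_n -> V => 0).
Proof.
split=> // [v s|]; first by rewrite mulr0.
by rewrite (_ : [set _ | _] = set0) //; apply/seteqP; split.
Qed.

Lemma ccochainsB n (z z' : cochain V n) :
  ccochains K L z -> ccochains K L z' -> ccochains K L (fun v => z v - z' v).
Proof.
move=> [z1 z2 z3] [z1' z2' z3'].
have H v : z v - z' v <> 0 -> z v <> 0 \/ z' v <> 0.
  by move=> H; apply: contrapT => /not_orP[/contrapT e /contrapT e']; rewrite e e' in H.
split=> [v /H[/z1|/z1'] //|v s|]; first by rewrite z2 z2' mulrBr.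
apply: (@sub_finite_set _ _ ([set v | z v <> 0] `|` [set v | z' v <> 0])).
  by move=> v /H.
by rewrite finite_setU.
Qed.

Lemma ccochainsN n (z : cochain V n) :
  ccochains K L z -> ccochains K L (fun v => - z v).
Proof.
move=> /(ccochainsB (ccochains0 n)); congr (ccochains K L _).
by apply/funext => v; rewrite sub0r.
Qed.

Lemma ccochainsD n (z z' : cochain V n) :
  ccochains K L z -> ccochains K L z' -> ccochains K L (fun v => z v + z' v).
Proof.
move=> hz /ccochainsN /(ccochainsB hz); congr (ccochains K L _).
by apply/funext => v; rewrite opprK.
Qed.

Lemma ccochains_sum n (I : Type) (r : seq I) (z : I -> cochain V n) :
  (forall i, ccochains K L (z i)) -> ccochains K L (fun v => \sum_(i <- r) z i v).
Proof.
move=> hz; elim: r => [|i r IH].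
  by under eq_fun do rewrite big_nil; exact: ccochains0.
by under eq_fun do rewrite big_cons; exact: ccochainsD.
Qed.

Lemma coboundaryB n (z z' : cochain V n) :
  coboundary K (fun v => z v - z' v) =
  (fun v => coboundary K z v - coboundary K z' v).
Proof.
apply/funext => v; rewrite /coboundary; case: ifP => _; last by rewrite subrr.
by rewrite -sumrB; apply: eq_bigr => i _; rewrite mulrBr.
Qed.

Lemma coboundary0 n : coboundary K (fun _ : 'I_n -> V => 0) = (fun=> 0).
Proof.
apply/funext => v; rewrite /coboundary; case: ifP => // _.
by rewrite big1 // => i _; rewrite mulr0.
Qed.

Lemma coboundaryN n (z : cochain V n) :
  coboundary K (fun v => - z v) = (fun v => - coboundary K z v).
Proof.
apply/funext => v; rewrite /coboundary; case: ifP => _; last by rewrite oppr0.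
by rewrite -sumrN; apply: eq_bigr => i _; rewrite mulrN.
Qed.

Lemma coboundaryD n (z z' : cochain V n) :
  coboundary K (fun v => z v + z' v) =
  (fun v => coboundary K z v + coboundary K z' v).
Proof.
apply/funext => v; rewrite /coboundary; case: ifP => _; last by rewrite addr0.
by rewrite -big_split; apply: eq_bigr => i _; rewrite mulrDr.
Qed.

Lemma coboundary_sum n (I : Type) (r : seq I) (z : I -> cochain V n) :
  coboundary K (fun v => \sum_(i <- r) z i v) =
  (fun v => \sum_(i <- r) coboundary K (z i) v).
Proof.
elim: r => [|i r IH].
  rewrite (_ : (fun v => _) = (fun=> 0)) ?coboundary0.
    by apply/funext => v; rewrite big_nil.
  by apply/funext => v; rewrite big_nil.
rewrite (_ : (fun v => _) = (fun v => z i v + \sum_(j <- r) z j v)).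
  by rewrite coboundaryD IH; apply/funext => v; rewrite big_cons.
by apply/funext => v; rewrite big_cons.
Qed.

(** Only the difference is constrained, so pullbacks can be compared without first showing that they
    are compactly supported. *)
Definition cohomologous n (z z' : cochain V n.+1) : Prop :=
  exists2 h : cochain V n, ccochains K L h &
    coboundary K h = (fun v => z v - z' v).

Lemma cohomologous_refl n (z : cochain V n.+1) : cohomologous z z.
Proof.
exists (fun=> 0); first exact: ccochains0.
by rewrite coboundary0; apply/funext => v; rewrite subrr.
Qed.

Lemma cohomologous_trans n (z2 z1 z3 : cochain V n.+1) :
  cohomologous z1 z2 -> cohomologous z2 z3 -> cohomologous z1 z3.
Proof.
move=> [h Ch Dh] [h' Ch' Dh']; exists (fun v => h v + h' v).
  exact: ccochainsD.
by rewrite coboundaryD Dh Dh'; apply/funext => v; rewrite addrA subrK.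
Qed.

End CochainGroups.

Lemma finite_tuples (V : choiceType) n (F : set V) :
  finite_set F -> finite_set [set v : 'I_n -> V | forall i, F (v i)].
Proof.
move=> /finite_seqP [s Fs].
apply: (@sub_finite_set _ _
  [set (fun i => val (g i)) | g in [set: {ffun 'I_n -> seq_sub s}]]).
  move=> v Hv.
  have Hs i : v i \in s by have := Hv i; rewrite Fs.
  exists [ffun i => SeqSub (Hs i)] => //.
  by apply/funext => i; rewrite ffunE.
exact/finite_image/finite_finset.
Qed.

Section Homotopy.
Context {V W : choiceType}.
Implicit Types (K L : set {fset V}) (f g : V -> W).

(* [t] ranges over the faces of f(s) u g(s), so the target need not be assumed
   closed under faces. *)
Definition contiguous K (K' : set {fset W}) f g : Prop :=
  forall s (t : {fset W}), K s -> t != fset0 ->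
    (forall w, w \in t -> exists2 y, y \in s & w = f y \/ w = g y) -> K' t.

(** [pullback] between two vertex sets; when these coincide the two are convertible, so the homotopy
    lemmas apply to refinement maps too. *)
Definition fpull K f n (z : cochain W n) : cochain V n :=
  fun v => if `[< K (vset v) >] then z (f \o v) else 0.

Lemma vset_neq0 (T : choiceType) n (v : 'I_n.+1 -> T) : vset v != fset0.
Proof. by apply/fset0Pn; exists (v ord0); apply/vsetP; exists ord0. Qed.

(* As f and g agree off x, inserting [g x] in front of f(v) for the v containing
   x gives a homotopy operator which preserves alternating cochains; the usual
   prism operator would require an ordering of the vertices. *)
Lemma homotopy_step K L (K' L' : set {fset W}) f g x n
    (z : cochain W n.+2) (F : set V) :
  face_closed K -> alternating z ->
  (forall w, z w <> 0 -> ~ L' (vset w)) ->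
  (forall w, K' (vset w) -> face_sum z w = 0) ->
  (forall y, y <> x -> f y = g y) ->
  contiguous K K' f g -> contiguous L L' f g ->
  finite_set F ->
  (forall y, K [fset y]%fset -> (exists w i, z w <> 0 /\ w i = f y) -> F y) ->
  cohomologous K L (fpull K f z) (fpull K g z).
Proof.
move=> Kcl za zL' zc fg KK' LL' Ff HF.
pose h (v : 'I_n.+1 -> V) := if `[< K (vset v) >] && (x \in vset v)
  then z (fcons (g x) (f \o v)) else 0.
have z'a := alternating_fcons (g x) za.
have ha : alternating h.
  split=> [v vni|v s]; rewrite /h.
    case: ifP => // _; apply: z'a.1 => fvi; apply: vni => i j e; apply: fvi.
    by rewrite /= e.
  rewrite vset_perm; case: ifP => _; last by rewrite mulr0.
  exact: (z'a.2 (f \o v) s).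
have vcons v w : x \in vset v -> w \in vset (fcons (g x) (f \o v)) ->
    exists2 y, y \in vset v & w = f y \/ w = g y.
  move=> xv /vsetP[k ->]; case: (unliftP ord0 k) => [k' ->|->].
    by rewrite fcons_lift; exists (v k'); [apply/vsetP; exists k'|left].
  by rewrite fcons0; exists x => //; right.
have K1 n' (v : 'I_n'.+1 -> V) i : K (vset v) -> K [fset v i]%fset.
  move=> Kv; apply: (Kcl _ _ Kv); first by apply/fset0Pn; exists (v i); rewrite inE.
  by apply/fsubsetP => y; rewrite inE => /eqP ->; apply/vsetP; exists i.
exists h.
  split=> [v|v s|]; last 2 first.
  - exact: ha.2.
  - apply: sub_finite_set (finite_tuples n.+1 Ff) => v.
    rewrite /= /h; case: ifP => // /andP[/asboolP Kv xv] zn i.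
    apply: HF; first exact: K1.
    exists (fcons (g x) (f \o v)), (lift ord0 i); split => //.
    by rewrite fcons_lift.
  - move=> hv; split.
    + by apply: contrapT => vni; apply: hv; exact: ha.1.
    + by move: hv; rewrite /h; case: ifP => // /andP[/asboolP].
    + move: hv; rewrite /h; case: ifP => // /andP[/asboolP Kv xv] /zL' nL Lv.
      apply: nL; apply: (LL' _ _ Lv); first exact: vset_neq0.
      by move=> w /(vcons _ _ _ xv).
apply/funext => v; rewrite coboundaryE /fpull.
case: asboolP => Kv; last by rewrite subrr.
have [vi|vni] := pselect (injective v); last first.
  rewrite face_sum_noninj // !za.1 ?subrr // => fvi; apply: vni => i j e; apply: fvi;
  by rewrite /= e.
have Kf i : K (vset (v \o lift i)).
  apply: (Kcl _ _ Kv); first exact: vset_neq0.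
  by apply/fsubsetP => y /vsetP[k ->]; apply/vsetP; exists (lift i k).
have [xv|/negP xv] := boolP (x \in vset v); last first.
  have efg : f \o v = g \o v.
    by apply/funext => k /=; apply: fg => e; apply: xv; apply/vsetP; exists k.
  rewrite efg subrr /face_sum big1 // => i _; rewrite /h.
  case: ifP; last by rewrite mulr0.
  move=> /andP[_ /vsetP[k e]]; exfalso; apply: xv.
  by rewrite e; apply/vsetP; exists (lift i k).
have /vsetP[i0 xi0] := xv.
(* By contiguity the cone from [g x] on f(v) is a simplex of [K'], where [z] is closed; the cone
   formula then expresses [z (f \o v)] through the other faces. *)
have : face_sum z (fcons (g x) (f \o v)) = 0.
  apply: zc; apply: (KK' _ _ Kv); first exact: vset_neq0.
  by move=> w /(vcons _ _ _ xv).
rewrite face_sum_fcons => /eqP; rewrite subr_eq0 => /eqP ->.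
rewrite /face_sum (bigD1 i0) //= [in RHS](bigD1 i0) //=.
have -> : h (v \o lift i0) = 0.
  rewrite /h; case: ifP => // /andP[_ /vsetP[k /=]]; rewrite xi0 => /vi /eqP.
  by rewrite (negPf (neq_lift _ _)).
(* The face omitting f(x) is g(v) with [g x] moved to the front; it contributes the term
   [z (g \o v)]. *)
have -> : fcons (g x) ((f \o v) \o lift i0) =
    fcons ((g \o v) i0) ((g \o v) \o lift i0).
  rewrite xi0; congr fcons; apply/funext => k /=; apply: fg; rewrite xi0 => /vi /eqP.
  by rewrite eq_sym (negPf (neq_lift _ _)).
rewrite alternating_move // mulr0 add0r addrAC subrr add0r.
apply: eq_bigr => i ii0; congr (_ * _); rewrite /h.
have -> : `[< K (vset (v \o lift i)) >] by apply/asboolP.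
suff -> : x \in vset (v \o lift i) by [].
apply/vsetP; have := unliftP i i0; case=> [k e|e].
  by exists k; rewrite /= -e.
by rewrite e eqxx in ii0.
Qed.

(** The values of [f] are replaced by those of [g] one vertex at a time. Finitely many replacements
    suffice, since outside [F] neither map meets the support of [z]. The intermediate maps take
    values among those of [f] and [g], so they stay contiguous to [g]. *)
Lemma homotopy_finite K L (K' L' : set {fset W}) f g n
    (z : cochain W n.+2) (F : set V) :
  face_closed K -> alternating z ->
  (forall w, z w <> 0 -> ~ L' (vset w)) ->
  (forall w, K' (vset w) -> face_sum z w = 0) ->
  contiguous K K' f g -> contiguous L L' f g ->
  finite_set F ->
  (forall y, K [fset y]%fset ->
     (exists w i, z w <> 0 /\ (w i = f y \/ w i = g y)) -> F y) ->
  cohomologous K L (fpull K f z) (fpull K g z).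
Proof.
move=> Kcl za zL' zc KK' LL' Ff HF.
have step (r : seq V) : forall f', contiguous K K' f' g -> contiguous L L' f' g ->
    (forall y, K [fset y]%fset ->
     (exists w i, z w <> 0 /\ (w i = f' y \/ w i = g y)) -> F y) ->
    cohomologous K L (fpull K f' z)
      (fpull K (fun y => if y \in r then g y else f' y) z).
  elim: r => [|x r IH] f' fK' fL' fF; first exact: cohomologous_refl.
  pose f1 y := if y == x then g y else f' y.
  have f1E y : f1 y = f' y \/ f1 y = g y.
    by rewrite /f1; case: ifP => _; [right|left].
  apply: (@cohomologous_trans _ _ _ _ (fpull K f1 z)).
    apply: (@homotopy_step K L K' L' f' f1 x n z F) => //.
    - by move=> y /eqP /negPf yx; rewrite /f1 yx.
    - move=> s t Ks t0 Ht; apply: (fK' _ _ Ks t0) => w /Ht[y ys [->|->]].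
        by exists y => //; left.
      by exists y.
    - move=> s t Ks t0 Ht; apply: (fL' _ _ Ks t0) => w /Ht[y ys [->|->]].
        by exists y => //; left.
      by exists y.
    - by move=> y Ky [w [i [zw wi]]]; apply: fF => //; exists w, i; split => //; left.
  have := IH f1; rewrite (_ : (fun y => if y \in x :: r then g y else f' y) =
      (fun y => if y \in r then g y else f1 y)).
    apply.
    - move=> s t Ks t0 Ht; apply: (fK' _ _ Ks t0) => w /Ht[y ys [->|->]].
        by exists y.
      by exists y => //; right.
    - move=> s t Ks t0 Ht; apply: (fL' _ _ Ks t0) => w /Ht[y ys [->|->]].
        by exists y.
      by exists y => //; right.
    - move=> y Ky [w [i [zw wi]]]; apply: fF => //; exists w, i; split => //.
      by case: wi => [->|->]; [exact: f1E|right].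
  apply/funext => y; rewrite inE /f1; case: (y == x) => //=.
  by case: ifP.
have /finite_seqP[r Fr] := Ff.
have := step r f KK' LL' HF; congr (cohomologous K L _ _).
apply/funext => v; rewrite /fpull; case: asboolP => // Kv.
(* A tuple with a vertex outside [r] is sent off the support of [z] by [g] as well as by the hybrid
   map, so both pullbacks vanish there. *)
have [vr|vr] := pselect (forall i, v i \in r).
  by congr z; apply/funext => i /=; rewrite vr.
have [i ir] : exists i, v i \notin r.
  apply: contrapT => H; apply: vr => i; apply: contrapT => /negP ir.
  by apply: H; exists i.
have Kvi : K [fset v i]%fset.
  apply: (Kcl _ _ Kv); first by apply/fset0Pn; exists (v i); rewrite inE.
  by apply/fsubsetP => y; rewrite inE => /eqP ->; apply/vsetP; exists i.
have nF : ~ F (v i) by rewrite Fr /=; apply/negP.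
have -> : z (g \o v) = 0.
  apply: contrapT => zn; apply/nF/HF => //.
  by exists (g \o v), i; split => //; right.
apply: contrapT => zn; apply/nF/HF => //.
exists ((fun y => if y \in r then g y else f y) \o v), i; split => //=.
by left; rewrite (negPf ir).
Qed.

End Homotopy.

(** * Nerves of an anti-Cech system *)

Section ProperCovers.
Context {R : realType} {Y : metricType R}.
Implicit Types (U : set (set Y)).

(** Compactness is used in its filter form, with the finite families of sets, directed by inclusion,
    as index: near each point some finite family already contains all members met. *)
Lemma compact_locfin_finite U (B : set Y) :
  compact B -> locally_finite_family U ->
  finite_set [set u | U u /\ u `&` B !=set0].
Proof.
move=> /compact_near_coveringP cB Uf.
pose up (s : {fset (set Y)}) := [set t : {fset (set Y)} | (s `<=` t)%fset].
have Fup : Filter (filter_from setT up).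
  apply: filter_from_filter; first by exists fset0.
  move=> s t _ _; exists (s `|` t)%fset => // r; rewrite /up /= fsubUset.
  by move=> /andP[].
have := cB _ _ (fun s x => forall u, U u -> u x -> u \in s) Fup.
case.
  move=> x Bx; have [G Gx finG] := Uf x.
  exists (G, up (fset_set [set u | U u /\ u `&` G !=set0])).
    by split => //=; exists (fset_set [set u | U u /\ u `&` G !=set0]).
  move=> [x' s] /= [Gx' /fsubsetP ss] u Uu ux; apply: ss.
  by rewrite in_fset_set // inE /=; split => //; exists x'.
move=> s _ /(_ s (fsubset_refl s)) /= Hs.
apply: (@sub_finite_set _ _ [set` s]) => // u [Uu [x [ux Bx]]] /=.
exact: (Hs x).
Qed.

Lemma edist_inf_ball (u : set Y) x (r : R) : 0 <= r ->
  (r%:E < edist_inf (~` u) x)%E -> forall y, mdist x y <= r -> u y.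
Proof.
move=> r0 h y xy; apply: contrapT => nuy.
(* A real [s] is inserted because the distance is infinite when [u] is the whole space; the midpoint
   of [r] and [s] then leaves room for an open ball. *)
have [s rs hs] : exists2 s, r < s & (s%:E <= edist_inf (~` u) x)%E.
  move: h; case: (edist_inf _ _) => [s||] //=; last first.
    by exists (r + 1); [rewrite ltrDl|rewrite leey].
  by rewrite lte_fin; exists s.
have : (edist (x, y) <= ((r + s) / 2)%:E)%E.
  apply: edist_fin => /=; first by rewrite divr_gt0 // ltr_wpDl // (le_lt_trans r0 rs).
  by rewrite ballEmdist /= (le_lt_trans xy) // midf_lt.
apply/negP; rewrite -ltNge.
have : (edist_inf (~` u) x <= edist (x, y))%E.
  by apply: ereal_inf_lbound; exists y.
apply: lt_le_trans; apply: lt_le_trans hs; rewrite lte_fin; exact: (midf_lt rs).2.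
Qed.

End ProperCovers.

Section System.
Context {R : realType} {Y : metricType R} (D : anti_cech_system Y).

Definition fine_at i (rho : R) : Prop :=
  forall x, exists2 u, acs_cover D i u & forall y, mdist x y <= rho -> u y.

Lemma Lebesgue_large (rho : R) : 0 <= rho ->
  exists i0, forall i, (i0 <= i)%N -> fine_at i rho.
Proof.
move=> r0.
have /cvgeyPgt /(_ rho) [i0 _ Hi0] := @acs_Lebesgue _ _ D.
exists i0 => i /Hi0 /= Li x.
have : (rho%:E < ereal_sup [set edist_inf (~` u) x | u in acs_cover D i])%E.
  by apply: lt_le_trans Li _; apply: ereal_inf_lbound; exists x.
move=> /ereal_sup_gt [_ [u Uu <-] hu]; exists u => //.
exact: edist_inf_ball.
Qed.

Lemma meshP : exists mesh : nat -> R, (forall i, 0 <= mesh i) /\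
  forall i u, acs_cover D i u -> diam_le mdist (mesh i) u.
Proof.
have [m Hm] := choice (@acs_bounded _ _ D).
exists (fun i => `|m i|); split => [i|i u Uu x y ux uy]; first exact: normr_ge0.
exact: le_trans (Hm i u Uu x y ux uy) (ler_norm _).
Qed.

(** A chosen nonnegative bound for the diameters at each stage, not their supremum. *)
Definition mesh := projT1 (cid meshP).

Lemma mesh_ge0 i : 0 <= mesh i.
Proof. by rewrite /mesh; case: cid => m /= [m0 h]. Qed.

Lemma meshE i u x y : acs_cover D i u -> u x -> u y -> mdist x y <= mesh i.
Proof.
by move=> Uu ux uy; rewrite /mesh; case: cid => m /= [m0 h]; exact: (h _ _ Uu).
Qed.

Lemma acs_coverT i x : exists2 u, acs_cover D i u & u x.
Proof.
have [c _] := @acs_irreducible _ _ D i; have : [set: Y] x by [].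
by rewrite -c => -[u]; exists u.
Qed.

Lemma cover_near_finite i a (r : R) : proper_space Y ->
  finite_set [set u | acs_cover D i u /\ exists2 x, u x & mdist a x <= r].
Proof.
move=> pY; apply: sub_finite_set
  (compact_locfin_finite (pY a r) (@acs_locfin _ _ D i)).
by move=> u [Uu [x ux xr]]; split => //; exists x.
Qed.

Lemma finite_cover_at i (a : Y) : finite_set [set u | acs_cover D i u /\ u a].
Proof.
have [G Ga] := @acs_locfin _ _ D i a; apply: sub_finite_set => u [Uu ua].
by split => //; exists a; split => //; exact: nbhs_singleton.
Qed.

Definition common_star i (a : Y) (P : set (set Y)) : Prop :=
  exists y, (forall u, P u -> u y) /\ (forall u, acs_cover D i u -> u a -> u y).

(** As [phi_u] vanishes exactly off [u], the closed simplices containing the projection of [a] are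
    those having all members through [a] among their vertices. This removes the partition of unity
    from the description of A_i. *)
Lemma acs_subP (A : set Y) i (s : {fset set Y}) :
  acs_sub D A i s <->
  acs_nerve D i s /\ exists2 a, A a & common_star i a [set` s].
Proof.
have [_ phi0 phiE phi1] := @acs_unityP _ _ D i.
have npE u a : acs_cover D i u ->
    nerve_proj (acs_cover D i) (acs_unity D i) a u = acs_unity D i u a.
  by move=> Uu; rewrite /nerve_proj mem_set.
split.
  move=> [Ns [s' [[s'0 s'U [y s'y]] ss' [t [[t0 off t1] [a Aa ea]]]]]]; split => //.
  exists a => //; exists y; split => [u us|u Uu ua].
    by apply: s'y; exact: (fsubsetP ss').
  apply: s'y; apply: contrapT => /negP /off; rewrite -ea npE // => e.
  have : (acs_unity D i u @^-1` [set 0]) a by [].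
  by rewrite phiE.
move=> [[s0 sU [y0 sy0]] [a Aa [y [sy ay]]]]; split; first by split => //; exists y0.
(* The simplex through the projection of [a] having [s] as a face is the join of [s] with the
   carrier of that projection. *)
pose sa := fset_set [set u | acs_cover D i u /\ u a].
have saP u : (u \in sa) <-> (acs_cover D i u /\ u a).
  by rewrite in_fset_set ?inE //; exact: finite_cover_at.
exists (s `|` sa)%fset; split.
- split.
  + have /fset0Pn[u us] := s0; apply/fset0Pn; exists u.
    by rewrite in_fsetU us.
  + by move=> u; rewrite in_fsetU => /orP[/sU|/saP[]].
  + exists y => u; rewrite in_fsetU => /orP[/sy|/saP[]] //; exact: ay.
- exact: fsubsetUl.
- exists (nerve_proj (acs_cover D i) (acs_unity D i) a); split; last by exists a.
  split.
  + move=> u; rewrite /nerve_proj; case: ifP => // /set_mem; exact: phi0.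
  + move=> u; rewrite in_fsetU negb_or => /andP[_ /negP usa].
    rewrite /nerve_proj; case: ifP => // /set_mem Uu.
    have : (~` u) a by move=> ua; apply: usa; apply/saP.
    by rewrite -phiE.
  + rewrite -(phi1 a) fsbig_seq ?fset_uniq //.
    rewrite (@eq_fsbigr _ _ _ _ _ (acs_unity D i ^~ a)); last first.
      move=> u /set_mem /=; rewrite in_fsetU => /orP[/sU|/saP[]] *; exact: npE.
    apply: fsbig_widen => u; first by rewrite /= in_fsetU => /orP[/sU|/saP[]].
    move=> [/= Uu nu]; have : (~` u) a.
      by move=> ua; apply: nu; rewrite in_fsetU; apply/orP; right; apply/saP.
    by rewrite -phiE.
Qed.

Lemma nerve_face_closed i : face_closed (acs_nerve D i).
Proof.
move=> s t [s0 sU [y sy]] t0 /fsubsetP ts; split => //; first by move=> u /ts /sU.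
by exists y => u /ts /sy.
Qed.

(** The target stage is written [k + i], so that [k.+1 + i] reduces to the successor of [k + i]. *)
Fixpoint refine k i (u : set Y) : set Y :=
  if k is k'.+1 then acs_refine D (k' + i) (refine k' i u) else u.

Lemma refineS k i u : refine k.+1 i u = refine k i.+1 (acs_refine D i u).
Proof.
elim: k => [//|k IH].
by rewrite [LHS]/= -/(refine k.+1 i u) IH /= addnS.
Qed.

Lemma refineP k i u : acs_cover D i u ->
  acs_cover D (k + i) (refine k i u) /\ u `<=` refine k i u.
Proof.
move=> Uu; elim: k => [|k [IH1 IH2]] /=; first by split.
have [h1 h2] := acs_refineP IH1; split => //; exact: subset_trans h2.
Qed.

(** The compatibility is applied to the one-point set {a}, so that the point witnessing membership
    in A_i stays the same along the tower. *)
Lemma acs_refine_star i a (s : {fset set Y}) :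
  acs_nerve D i s -> common_star i a [set` s] ->
  common_star i.+1 a [set` [fset acs_refine D i u | u in s]%fset].
Proof.
move=> Ns sa.
have /acs_star : acs_sub D [set a] i s by apply/acs_subP; split => //; exists a.
by move=> /acs_subP[_ [_ -> ]].
Qed.

Lemma refine_star k i a (s : {fset set Y}) :
  acs_nerve D i s -> common_star i a [set` s] ->
  exists y, (forall u, u \in s -> refine k i u y) /\
            (forall u, acs_cover D (k + i) u -> u a -> u y).
Proof.
move=> Ns sa; have [s0 sU [x sx]] := Ns.
suff [y [h1 h2]] : common_star (k + i) a [set` [fset refine k i u | u in s]%fset].
  by exists y; split => // u us; apply: h1; apply/imfsetP; exists u.
elim: k => [|k IH].
  have [y [h1 h2]] := sa; exists y; split => // _ /imfsetP[u /= us ->]; exact: h1.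
have {IH} := acs_refine_star _ IH; case=> [|y [h1 h2]].
  split.
  - have /fset0Pn[u us] := s0; apply/fset0Pn; exists (refine k i u).
    by apply/imfsetP; exists u.
  - by move=> _ /imfsetP[u /= /sU us ->]; have [] := refineP k us.
  - exists x => _ /imfsetP[u /= us ->]; have [_] := refineP k (sU u us); apply.
    exact: sx.
exists y; split => // _ /imfsetP[u /= us ->]; apply: h1 => /=.
by apply/imfsetP; exists (refine k i u) => //; apply/imfsetP; exists u.
Qed.

End System.

(** * The cohomology towers are pro-zero *)

Definition support_vertices (V : choiceType) n (z : cochain V n) : set V :=
  [set x | exists w i, z w <> 0 /\ w i = x].

Lemma support_vertices_finite (V : choiceType) (K L : set {fset V}) n
    (z : cochain V n) : ccochains K L z -> finite_set (support_vertices z).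
Proof.
move=> [_ _ zf].
apply: (@sub_finite_set _ _
  (\bigcup_(w in [set w | z w <> 0]) [set w i | i in [set: 'I_n]])).
  by move=> x [w [i [zw <-]]]; exists w => //; exists i.
by apply: bigcup_finite => // w _; exact/finite_image/finite_finset.
Qed.

Lemma vset_comp (V W : choiceType) (f : V -> W) n (v : 'I_n -> V) :
  vset (f \o v) = [fset f x | x in vset v]%fset.
Proof.
apply/fsetP => y; apply/vsetP/imfsetP => /= [[k ->]|[x /vsetP[k ->] ->]].
  by exists (v k) => //; apply/vsetP; exists k.
by exists k.
Qed.

(** * Weighting a cochain by the position of the label of largest colour *)

Section TopLabel.
Context {V W : choiceType} (c : nat) (col : W -> 'I_c) (pos : pred W) (g : W -> V).

(** When the colours determine the labels, the label of largest colour is unique and this is its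
    position; the existential form is permutation invariant on all tuples. *)
Definition top_pos n (w : 'I_n -> W) : bool :=
  [exists i, pos (w i) && [forall j, (col (w j) <= col (w i))%N]].

Definition top_cochain n (z : cochain V n) : cochain W n :=
  fun w => if top_pos w then z (g \o w) else 0.

Lemma top_pos_perm n (w : 'I_n -> W) (s : 'S_n) : top_pos (w \o s) = top_pos w.
Proof.
apply/existsP/existsP => /= -[i /andP[pi /forallP ci]].
  exists (s i); rewrite pi; apply/forallP => j.
  by have := ci ((s^-1)%g j); rewrite permKV.
exists ((s^-1)%g i); rewrite permKV pi; apply/forallP => j; exact: ci.
Qed.

Lemma top_posT n (w : 'I_n.+1 -> W) : (forall i, pos (w i)) -> top_pos w.
Proof.
move=> pw; apply/existsP.
case: (@arg_maxnP _ ord0 xpredT (fun i => col (w i))) => // i _ Hi.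
by exists i; rewrite pw; apply/forallP => j; exact: Hi.
Qed.

Lemma alternating_top n (z : cochain V n) :
  alternating z -> alternating (top_cochain z).
Proof.
move=> [z0 zs]; split=> [w wni|w s]; rewrite /top_cochain.
  case: ifP => // _; apply: z0 => gw; apply: wni => i j e; apply: gw.
  by rewrite /= e.
rewrite top_pos_perm; case: ifP => _; last by rewrite mulr0.
exact: (zs (g \o w) s).
Qed.

(** By pigeonhole, [n.+1] vertices cannot carry distinct colours out of [c <= n], so two labels
    coincide and the alternating face sum vanishes. *)
Lemma top_cocycle n (z : cochain V n) (w : 'I_n.+1 -> W) :
  alternating z -> (c <= n)%N ->
  (forall x y, x \in vset w -> y \in vset w -> col x = col y -> x = y) ->
  face_sum (top_cochain z) w = 0.
Proof.
move=> za cn cw; apply: face_sum_noninj; first exact: alternating_top.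
move=> wi; have : injective (col \o w).
  by move=> i j /= e; apply: wi; apply: cw => //; apply/vsetP; [exists i|exists j].
by move=> /leq_card; rewrite !card_ord leqNgt ltnS cn.
Qed.

End TopLabel.

(** * Killing cocycles by sliding the height in Y x R *)

Section ProZero.
Context {R : realType} {Y : metricType R} (D : anti_cech_system Y).
Context (pY : proper_space Y) (y0 : Y).

Lemma member_near_finite i j (v : set Y) : acs_cover D j v ->
  finite_set [set u | acs_cover D i u /\ exists2 x, u x & v x].
Proof.
move=> Uv; have [[a va]|nv] := pselect (exists a, v a).
  apply: sub_finite_set (cover_near_finite D i a (mesh D j) pY).
  by move=> u [Uu [x ux vx]]; split => //; exists x => //; exact: meshE Uv _ _.
apply: (@sub_finite_set _ _ set0) => // u [_ [x _ vx]]; apply: nv; by exists x.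
Qed.

(** A map of vertices that enlarges each member sends only these vertices into the support of [z];
    the set serves as [F] in the homotopy lemma. *)
Lemma near_support_finite i j L n (z : cochain (set Y) n) :
  ccochains (acs_nerve D j) L z ->
  finite_set [set u | acs_cover D i u /\
    exists2 v, support_vertices z v & exists2 x, u x & v x].
Proof.
move=> zc; have [z1 _ _] := zc.
apply: (@sub_finite_set _ _ (\bigcup_(v in support_vertices z)
   [set u | acs_cover D i u /\ exists2 x, u x & v x])).
  by move=> u [Uu [v zv [x ux vx]]]; exists v => //; split => //; exists x.
apply: bigcup_finite => [|v [w [k [/z1[_ [_ Nw _] _] <-]]]].
  exact: support_vertices_finite zc.
by apply: (@member_near_finite _ j); apply: Nw; apply/vsetP; exists k.
Qed.

(** A common point of the simplex lies in all the enlarged members, which therefore span a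
    simplex. *)
Lemma contiguous_nerve i j (f g : set Y -> set Y) :
  (forall s u, acs_nerve D i s -> u \in s -> acs_cover D j (f u) /\ u `<=` f u) ->
  (forall s u, acs_nerve D i s -> u \in s -> acs_cover D j (g u) /\ u `<=` g u) ->
  contiguous (acs_nerve D i) (acs_nerve D j) f g.
Proof.
move=> Hf Hg s t Ns t0 Ht; have [_ _ [y sy]] := Ns; split => //.
  move=> w /Ht[u us [->|->]]; first by have [] := Hf _ _ Ns us.
  by have [] := Hg _ _ Ns us.
exists y => w /Ht[u us [->|->]].
  by have [_] := Hf _ _ Ns us; apply; exact: sy.
by have [_] := Hg _ _ Ns us; apply; exact: sy.
Qed.

Lemma refine_nerve k i s u : acs_nerve D i s -> u \in s ->
  acs_cover D (k + i) (refine D k i u) /\ u `<=` refine D k i u.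
Proof. by move=> [_ Ns _] /Ns; exact: refineP. Qed.

(* [f] stands for a map with [a \in f u] whenever u is in the star of a. Only the
   sharper condition on [f], and not contiguity in the nerve, keeps the homotopy
   between the refinement map and [f] relative to A. *)
Lemma contiguous_refine_big A k i (f : set Y -> set Y) :
  (forall s u, acs_nerve D i s -> u \in s ->
     acs_cover D (k + i) (f u) /\ u `<=` f u) ->
  (forall s u a, acs_nerve D i s -> u \in s -> common_star D i a [set` s] -> f u a) ->
  contiguous (acs_sub D A i) (acs_sub D A (k + i)) (refine D k i) f.
Proof.
move=> Uf bf s t /acs_subP[Ns [a Aa sa]] t0 Ht; apply/acs_subP; split.
  apply: (contiguous_nerve (@refine_nerve k i) Uf Ns t0 Ht).
exists a => //; have [y [h1 h2]] := refine_star k Ns sa.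
exists y; split => // w /Ht[u us [->|->]]; first exact: h1.
by apply: h2; [have [] := Uf _ _ Ns us|exact: bf us sa].
Qed.

(** The stage [k0] depends on [i] alone, not on [A], the degree or [z]. A cochain on [n.+3] vertices
    has degree at least 2, as the pigeonhole over three colours requires. *)
Lemma pro_zero i (asY : asdim_le (@l1_dist R Y) 2) :
  exists k0, forall k, (k0 <= k)%N ->
  forall A n (z : cochain (set Y) n.+3),
  ccochains (acs_nerve D (k + i)) (acs_sub D A (k + i)) z ->
  coboundary (acs_nerve D (k + i)) z = (fun=> 0) ->
  exists2 h, ccochains (acs_nerve D i) (acs_sub D A i) h &
    coboundary (acs_nerve D i) h = pullback (acs_nerve D i) (refine D k i) z.
Proof.
pose m := mesh D i; have m0 : 0 <= m := mesh_ge0 D i.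
(* Base points of two members with a common point are at distance at most [m + m], and neighbouring
   heights differ by at most 1. *)
have r0 : 0 < m + m + 1 :> R by rewrite ltr_wpDl // addr_ge0.
have [Dw [F [Fdisj Fdiam Fcov]]] := asY _ r0.
pose W := ('I_3 * set (Y * R))%type.
have /choice[lam Hlam] : forall p, exists w : W, F w.1 w.2 /\ w.2 p.
  by move=> p; have [c [B]] := Fcov p; exists (c, B).
(* [Dw] leads from the chosen point of a label to the base point of [u], and [m + m] from there to
   any point of [A] in whose star [u] lies. *)
pose rho := `|Dw| + (m + m).
have rho0 : 0 <= rho by rewrite addr_ge0 // addr_ge0.
have [k0 Hk0] := Lebesgue_large D rho0.
exists k0 => k k0k A n z zc dz.
have /Hk0 fj : (k0 <= k + i)%N by exact: leq_trans (leq_addr _ _).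
have /choice[Vb HVb] : forall x, exists v,
    acs_cover D (k + i) v /\ forall y, mdist x y <= rho -> v y.
  by move=> x; have [v] := fj x; exists v.
pose yU (u : set Y) := xget y0 u.
pose pw (w : W) := xget (y0, 0 : R) w.2.
pose psi (t : R) u := lam (yU u, t).
pose g (w : W) := Vb (pw w).1.
have yUP s u : acs_nerve D i s -> u \in s -> u (yU u).
  by move=> [_ _ [y sy]] us; apply: (xgetPex y0); exists y; exact: sy.
have psiD t u : l1_dist (pw (psi t u)) (yU u, t) <= Dw.
  have [h1 h2] := Hlam (yU u, t); apply: (Fdiam _ _ h1) => //.
  by apply: (xgetPex (y0, 0 : R)); exists (yU u, t).
have psi1 t u : mdist (pw (psi t u)).1 (yU u) <= Dw.
  by apply: le_trans (psiD t u); rewrite lerDl.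
have psi2 t u : `|(pw (psi t u)).2 - t| <= Dw.
  by apply: le_trans (psiD t u); rewrite lerDr mdist_ge0.
have gU w : acs_cover D (k + i) (g w) by have [] := HVb (pw w).1.
have big t u x : mdist (yU u) x <= m + m -> g (psi t u) x.
  move=> ux; have [_] := HVb (pw (psi t u)).1; apply.
  apply: le_trans (metric_triangle _ (yU u) _) _; apply: lerD => //.
  exact: le_trans (psi1 t u) (ler_norm _).
have cU s u : acs_nerve D i s -> u \in s -> acs_cover D i u.
  by move=> [_ h _] /h.
have sub t s u : acs_nerve D i s -> u \in s ->
    acs_cover D (k + i) (g (psi t u)) /\ u `<=` g (psi t u).
  move=> Ns us; split => // x ux; apply: big; rewrite -[X in X <= _]addr0.
  by apply: lerD => //; apply: meshE (cU _ _ Ns us) _ ux; exact: yUP Ns us.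
have bigs t s u a : acs_nerve D i s -> u \in s ->
    common_star D i a [set` s] -> g (psi t u) a.
  move=> Ns us [y [sy ay]]; apply: big.
  apply: le_trans (metric_triangle _ y _) _; apply: lerD.
    by apply: meshE (cU _ _ Ns us) _ _; [exact: yUP Ns us|exact: sy].
  have [v Uv va] := acs_coverT D i a; exact: meshE Uv (ay v Uv va) va.
pose pos (w : W) := 0 < (pw w).2.
pose u := top_cochain (fun w : W => w.1) pos g z.
have za := alternating_ccochains zc.
have ua : alternating u by exact: alternating_top.
(* The complex of labels: its simplices have at most one label of each colour. [L'] is the preimage
   of A_j, on which [u] vanishes. *)
pose K' := [set s : {fset W} |
  forall x y, x \in s -> y \in s -> x.1 = y.1 -> x = y].
pose L' := [set s : {fset W} | acs_sub D A (k + i) [fset g w | w in s]%fset].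
pose N := acs_nerve D i; pose L := acs_sub D A i.
pose F0 := [set u | acs_cover D i u /\
    exists2 v, support_vertices z v & exists2 x, u x & v x].
have F0f : finite_set F0 by exact: near_support_finite zc.
have uz w : u w <> 0 -> z (g \o w) <> 0.
  by rewrite /u /top_cochain; case: ifP.
have F0P (f : set Y -> set Y) y v : N [fset y]%fset -> y `<=` f y ->
    support_vertices z v -> v = f y -> F0 y.
  move=> Ny yf zv e; split; first by have [_ h _] := Ny; apply: h; rewrite inE.
  have [_ _ [x sx]] := Ny; have yx : y x by apply: sx; rewrite inE.
  by exists v => //; exists x => //; rewrite e; exact: yf.
have F0psi t y w l : N [fset y]%fset -> u w <> 0 -> w l = psi t y -> F0 y.
  move=> Ny uw e; have [|_ sy] := sub t _ y Ny; first by rewrite inE.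
  apply: (F0P (g \o psi t) y (g (psi t y)) Ny) => //.
  by exists (g \o w), l; split; [exact: uz|rewrite /= e].
have Ncl : face_closed N by exact: nerve_face_closed.
have step (ta tb : R) : `|ta - tb| <= 1 ->
    cohomologous N L (fpull N (psi ta) u) (fpull N (psi tb) u).
  move=> dab; apply: (@homotopy_finite _ _ N L K' L' _ _ _ _ F0) => //.
  - move=> w /uz zw; rewrite /L' /= -vset_comp => Lw.
    by have [/(_ _ zw)[]] := zc.
  - by move=> w Kw; exact: top_cocycle.
  - move=> s q Ns q0 Hq.
    have lamP w : w \in q -> exists p : Y * R, [/\ exists2 v, v \in s & p.1 = yU v,
        p.2 = ta \/ p.2 = tb & w = lam p].
      move=> /Hq[v vs [->|->]]; [exists (yU v, ta)|exists (yU v, tb)]; split=> //=.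
      - by exists v.
      - by left.
      - by exists v.
      - by right.
    move=> x x' /lamP[p [[v vs pv] pt ->]] /lamP[p' [[v' vs' pv'] pt' ->]] e.
    have [h1 h2] := Hlam p; have [h1' h2'] := Hlam p'.
    rewrite [lam p]surjective_pairing [lam p']surjective_pairing e; congr pair.
    apply: contrapT => ne; rewrite -e in h1'.
    (* Distinct sets of one colour are more than [m + m + 1] apart, while these two contain points
       within that distance. *)
    have := Fdisj _ _ _ h1 h1' ne _ _ h2 h2'; apply/negP; rewrite -leNgt.
    rewrite /l1_dist; apply: lerD.
      have [_ _ [y sy]] := Ns.
      apply: le_trans (metric_triangle _ y _) _; rewrite pv pv'; apply: lerD.
        by apply: meshE (cU _ _ Ns vs) _ _; [exact: yUP Ns vs|exact: sy].
      by apply: meshE (cU _ _ Ns vs') _ _; [exact: sy|exact: yUP Ns vs'].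
    by case: pt => ->; case: pt' => ->; rewrite ?subrr ?normr0 // distrC.
  - move=> s q /acs_subP[Ns [a Aa sa]] /fset0Pn[w0 w0q] Hq; apply/acs_subP.
    (* All the sets [g w] contain [a], so [a] itself is the common point needed for the star. *)
    have qa w : w \in q -> g w a.
      by move=> /Hq[v vs [->|->]]; exact: bigs sa.
    have qa' v : v \in [fset g w | w in q]%fset -> v a.
      by move=> /imfsetP[w /= /qa ? ->].
    split; last by exists a => //; exists a.
    split; last by exists a.
    + by apply/fset0Pn; exists (g w0); apply/imfsetP; exists w0.
    + by move=> _ /imfsetP[w _ ->].
  - by move=> y Ny [w [l [uw [e|e]]]]; exact: F0psi uw e.
(* The chosen point of a label is within [Dw] of the height it labels, so at height [T] all labels
   are positive. *)
pose T := `|Dw| + 1.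
have walk l : cohomologous N L (fpull N (psi T) u) (fpull N (psi (T - l%:R)) u).
  elim: l => [|l IH]; first by rewrite subr0; exact: cohomologous_refl.
  apply: cohomologous_trans IH _; apply: step.
  have -> : T - l%:R - (T - l.+1%:R) = 1 by rewrite -natr1; lra.
  by rewrite normr1.
have top : fpull N (psi T) u = fpull N (g \o psi T) z.
  apply/funext => v; rewrite /fpull; case: ifP => // _.
  rewrite /u /top_cochain top_posT // => l; rewrite /pos /=.
  have := psi2 T (v l); rewrite ler_norml => /andP[h _].
  have := ler_norm Dw; rewrite /T /psi in h *; lra.
(* After [l] unit steps down no label is positive, and the weighted cochain pulls back to 0. *)
have [l Hl] : exists l : nat, T + `|Dw| <= l%:R.
  exists (Num.truncn (T + `|Dw|)).+1; apply/ltW/truncnS_gt.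
have bottom : fpull N (psi (T - l%:R)) u = (fun=> 0).
  apply/funext => v; rewrite /fpull; case: ifP => // _.
  rewrite /u /top_cochain; case: ifP => // /existsP[q /andP[]]; rewrite /pos /=.
  move=> h _; exfalso; move: h; apply/negP; rewrite -leNgt.
  have := psi2 (T - l%:R) (v q); rewrite ler_norml => /andP[_ h].
  have := ler_norm Dw; rewrite /psi in h *; lra.
have qf : cohomologous N L (pullback N (refine D k i) z) (fpull N (g \o psi T) z).
  apply: (@homotopy_finite _ _ N L (acs_nerve D (k + i)) (acs_sub D A (k + i))
     _ _ _ _ F0) => //.
  - by move=> w zw; have [/(_ _ zw)[]] := zc.
  - move=> w Kw; have := congr1 (fun f => f w) dz; rewrite coboundaryE.
    by case: asboolP.
  - apply: contiguous_nerve; [exact: refine_nerve|exact: sub].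
  - apply: contiguous_refine_big; [exact: sub|exact: bigs].
  - move=> y Ny [w [q [zw e]]]; have yy : y \in [fset y]%fset by rewrite inE.
    have zwq : support_vertices z (w q) by exists w, q.
    case: e => e.
      by apply: (F0P _ _ _ Ny _ zwq e); have [] := refine_nerve k Ny yy.
    by apply: (F0P _ _ _ Ny _ zwq e); have [] := sub T _ _ Ny yy.
have := cohomologous_trans qf; rewrite -top => /(_ _ (walk l)) [h Ch Dh].
exists h => //; rewrite Dh bottom; apply/funext => v; exact: subr0.
Qed.

End ProZero.

(** * Vanishing in degrees at least 3 *)

Section Vanishing.
Context {R : realType} {Y : metricType R} (D : anti_cech_system Y).
Context (pY : proper_space Y).
Implicit Types (A : set Y) (i k d : nat).

Let N := acs_nerve D.
Let sub := acs_sub D.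

Lemma refine_vset k i n (v : 'I_n -> set Y) :
  N i (vset v) -> N (k + i) (vset (refine D k i \o v)).
Proof.
have rn := @refine_nerve _ _ D k i; move=> Nv; apply: (contiguous_nerve rn rn Nv).
  have [/fset0Pn[u /vsetP[l _]] _ _] := Nv.
  by apply/fset0Pn; exists ((refine D k i \o v) l); apply/vsetP; exists l.
by move=> w /vsetP[l ->]; exists (v l); [apply/vsetP; exists l|left].
Qed.

Lemma refine_vset_sub k i A n (v : 'I_n -> set Y) :
  sub A i (vset v) -> sub A (k + i) (vset (refine D k i \o v)).
Proof.
move=> /acs_subP[Nv [a Aa sa]]; apply/acs_subP; split; first exact: refine_vset.
exists a => //; have [y [h1 h2]] := refine_star k Nv sa.
by exists y; split => // w /vsetP[l ->]; apply: h1; apply/vsetP; exists l.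
Qed.

Lemma pullback_ccochains k i A n (z : cochain (set Y) n) :
  ccochains (N (k + i)) (sub A (k + i)) z ->
  ccochains (N i) (sub A i) (pullback (N i) (refine D k i) z).
Proof.
move=> zc; have [z1 z2 z3] := zc; split.
- move=> v; rewrite /pullback; case: ifP => // /asboolP Nv /z1[qi _ nL]; split => //.
    by move=> j j' e; apply: qi; rewrite /= e.
  by move=> /(refine_vset_sub k).
- move=> v s; rewrite /pullback vset_perm; case: ifP => _; last by rewrite mulr0.
  by rewrite -z2.
- apply: sub_finite_set (finite_tuples n (near_support_finite pY i zc)) => v /=.
  rewrite /pullback; case: ifP => // /asboolP Nv zv l; have lv : v l \in vset v.
    by apply/vsetP; exists l.
  have [_ /(_ _ lv) Ul [y vy]] := Nv; split => //.
  exists (refine D k i (v l)); first by exists (refine D k i \o v), l.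
  by exists y; [exact: vy|apply: (refineP k Ul).2; exact: vy].
Qed.

Lemma coboundary_pullback k i n (z : cochain (set Y) n.+1) :
  coboundary (N i) (pullback (N i) (refine D k i) z) =
  pullback (N i) (refine D k i) (coboundary (N (k + i)) z).
Proof.
apply/funext => v; rewrite /coboundary /pullback; case: ifP => // /asboolP Nv.
have -> : `[< N (k + i) (vset (refine D k i \o v)) >].
  by apply/asboolP; exact: refine_vset.
apply: eq_bigr => l _; congr (_ * _).
suff -> : `[< N i (vset (v \o lift l)) >] by [].
apply/asboolP; apply: (@nerve_face_closed _ _ D i _ _ Nv); first exact: vset_neq0.
by apply/fsubsetP => y /vsetP[m ->]; apply/vsetP; exists (lift l m).
Qed.

Lemma pullback0 i A n (z : cochain (set Y) n) :
  ccochains (N i) (sub A i) z -> pullback (N i) (refine D 0 i) z = z.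
Proof.
move=> [z1 _ _]; apply/funext => v; rewrite /pullback; case: ifP => // /asboolP Nv.
by apply/esym; apply: contrapT => /z1[_].
Qed.

Lemma pullbackS k i n (z : cochain (set Y) n) :
  pullback (N i) (acs_refine D i) (pullback (N i.+1) (refine D k i.+1) z) =
  pullback (N i) (refine D k.+1 i) z.
Proof.
apply/funext => v; rewrite /pullback; case: ifP => // /asboolP Nv.
have -> : `[< N i.+1 (vset (acs_refine D i \o v)) >].
  by apply/asboolP; exact: (@refine_vset 1).
by congr z; apply/funext => l; rewrite [RHS]/= -/(refine D k.+1 i (v l)) refineS.
Qed.

Lemma pullbackB (K : set {fset set Y}) q n (z z' : cochain (set Y) n) :
  pullback K q (fun v => z v - z' v) = (fun v => pullback K q z v - pullback K q z' v).
Proof.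
by apply/funext => v; rewrite /pullback; case: ifP => // _; rewrite subrr.
Qed.

Lemma cohomologous_pullback k i A n (z z' : cochain (set Y) n.+2) :
  cohomologous (N (k + i)) (sub A (k + i)) z z' ->
  cohomologous (N i) (sub A i) (pullback (N i) (refine D k i) z)
                               (pullback (N i) (refine D k i) z').
Proof.
move=> [h Ch Dh]; exists (pullback (N i) (refine D k i) h).
  exact: pullback_ccochains.
by rewrite coboundary_pullback Dh pullbackB.
Qed.

(** The [b i] make the classes of the [a i] a thread of the inverse limit. *)
Lemma tel_cohomologous A n (a : nat -> cochain (set Y) n.+2)
    (b : nat -> cochain (set Y) n.+1) :
  (forall i, ccochains (N i) (sub A i) (a i)) ->
  (forall i, ccochains (N i) (sub A i) (b i)) ->
  (forall i, coboundary (N i) (b i) =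
     (fun v => pullback (N i) (acs_refine D i) (a i.+1) v - a i v)) ->
  forall d i, cohomologous (N i) (sub A i)
    (pullback (N i) (refine D d i) (a (d + i)%N)) (a i).
Proof.
move=> Ca Cb ab; elim=> [|d IH] i.
  by rewrite (pullback0 (Ca i)); exact: cohomologous_refl.
apply: (@cohomologous_trans _ _ _ _ (pullback (N i) (acs_refine D i) (a i.+1))).
  rewrite -pullbackS addSnnS; apply: (@cohomologous_pullback 1); exact: IH.
by exists (b i).
Qed.

Context (y0 : Y) (asY : asdim_le (@l1_dist R Y) 2).

(** Both components of a telescope cocycle have degree at least 2, so [pro_zero] handles the first
    (lim) and then, after correction, the second (lim^1). *)
Lemma HX_vanish A k : ~ HX_neq0 D A k.+3.
Proof.
move=> [[a b] [[Cab dab] nz]]; apply: nz.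
have Ca i : ccochains (N i) (sub A i) (a i) by have [] := Cab i.
have Cb i : ccochains (N i) (sub A i) (b i) by have [] := Cab i.
have da i : coboundary (N i) (a i) = (fun=> 0).
  exact: (congr1 (fun z => z.1 i) dab).
have db i : coboundary (N i) (b i) =
    (fun v => pullback (N i) (acs_refine D i) (a i.+1) v - a i v).
  apply/funext => v; have := congr1 (fun z => z.2 i v) dab.
  by rewrite /telD /= => /eqP; rewrite subr_eq0 => /eqP.
have /choice[J0 HJ0] := fun i => @pro_zero _ _ D pY y0 i asY.
(* The class of [a i] comes from a stage so late that its pullback is a coboundary. *)
have /choice[c Hc] : forall i, exists c, ccochains (N i) (sub A i) c /\
    coboundary (N i) c = a i.
  move=> i; have [h Ch Dh] := HJ0 i _ (leqnn _) A _ _ (Ca _) (da _).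
  have [h' Ch' Dh'] := tel_cohomologous Ca Cb db (J0 i) i.
  exists (fun v => h v - h' v); split; first exact: ccochainsB.
  by rewrite coboundaryB Dh Dh'; apply/funext => v; rewrite subKr.
pose q i n := @pullback (set Y) (N i) (acs_refine D i) n.
(* Subtracting the telescope coboundary of (c, 0) leaves (0, b'), with each [b' i] a cocycle. *)
pose b' i v := b i v - (q i _ (c i.+1) v - c i v).
have Cq i n (z : cochain (set Y) n) : ccochains (N i.+1) (sub A i.+1) z ->
    ccochains (N i) (sub A i) (q i n z).
  exact: (@pullback_ccochains 1).
have Dq i n (z : cochain (set Y) n.+1) : coboundary (N i) (q i _ z) =
    q i _ (coboundary (N i.+1) z).
  exact: (@coboundary_pullback 1).
have Cb' i : ccochains (N i) (sub A i) (b' i).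
  apply: ccochainsB => //; apply: ccochainsB; last exact: (Hc i).1.
  apply: Cq; exact: (Hc _).1.
have db' i : coboundary (N i) (b' i) = (fun=> 0).
  rewrite /b' coboundaryB coboundaryB Dq (Hc i).2 (Hc i.+1).2 db.
  by apply/funext => v; rewrite subrr.
(* Partial sums make the cut-offs monotone, so that the sum from [J i] to [(J i.+1).+1] is a genuine
   difference of truncated sums; all its terms are beyond [J0 i]. *)
pose J i := \sum_(l < i.+1) J0 l.
have JJ0 i : (J0 i <= J i)%N by rewrite /J big_ord_recr leq_addl.
have JS i : (J i <= (J i.+1).+1)%N.
  by rewrite [J i.+1]big_ord_recr -addnS leq_addr.
pose E i d := pullback (N i) (refine D d i) (b' (d + i)%N).
have EC i d : ccochains (N i) (sub A i) (E i d) by exact: pullback_ccochains.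
have ED i d : coboundary (N i) (E i d) = (fun=> 0).
  rewrite coboundary_pullback db'; apply/funext => v.
  by rewrite /pullback; case: ifP.
have /choice[e He] : forall i, exists e, ccochains (N i) (sub A i) e /\
    coboundary (N i) e = (fun v => \sum_(J i <= d < (J i.+1).+1) E i d v).
  move=> i; have /choice[h Hh] : forall r, exists h, ccochains (N i) (sub A i) h /\
      coboundary (N i) h = E i (r + J i)%N.
    move=> r; have rJ : (J0 i <= r + J i)%N by exact: leq_trans (leq_addl _ _).
    by have [h] := HJ0 i _ rJ A _ _ (Cb' _) (db' _); exists h.
  exists (fun v => \sum_(r <- iota 0 ((J i.+1).+1 - J i)) h r v); split.
    by apply: ccochains_sum => r; have [] := Hh r.
  rewrite coboundary_sum; apply/funext => v.
  rewrite -{2}[J i]add0n big_addn /index_iota subn0.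
  by apply: eq_bigr => r _; rewrite (Hh r).2.
(* The formal solution - sum_(d >= 0) q^* b'_(d + i) of the lim^1 equation, cut off
   where its terms become coboundaries [E i d]. *)
pose c2 i v := - \sum_(0 <= d < J i) E i d v.
have Cc2 i : ccochains (N i) (sub A i) (c2 i).
  by apply: ccochainsN; exact: ccochains_sum.
have Dc2 i : coboundary (N i) (c2 i) = (fun=> 0).
  rewrite coboundaryN coboundary_sum; apply/funext => v.
  by rewrite big1 ?oppr0 // => d _; rewrite ED.
have Sc2 i v : q i _ (c2 i.+1) v - c2 i v =
    b' i v - \sum_(J i <= d < (J i.+1).+1) E i d v.
  (* Pulling back from stage [i.+1] shifts [d] by one, so the truncated series telescopes to [b' i]
     up to terms that are coboundaries. *)
  have -> : q i _ (c2 i.+1) v = - \sum_(0 <= d < J i.+1) E i d.+1 v.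
    rewrite /q /pullback; case: ifP => [Nv|nNv]; last first.
      by rewrite big1 ?oppr0 // => d _; rewrite /E /pullback nNv.
    congr (- _); apply: eq_bigr => d _.
    by rewrite {2}/E -pullbackS {1}/pullback Nv addSnnS.
  rewrite opprK; have E0 : E i 0%N = b' i by exact: pullback0.
  rewrite -E0 addrC.
  have e1 : \sum_(0 <= d < (J i.+1).+1) E i d v =
      \sum_(0 <= d < J i) E i d v + \sum_(J i <= d < (J i.+1).+1) E i d v.
    by rewrite -big_cat_nat.
  rewrite big_nat_recl // in e1.
  by rewrite addrC -[in RHS](addrK (\sum_(0 <= d < J i.+1) E i d.+1 v) (E i 0%N v))
     e1; lra.
exists ((fun i v => c i v + c2 i v), (fun i v => - e i v)).
  move=> i; split; first by apply: ccochainsD => //; exact: (Hc i).1.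
  by apply: ccochainsN; exact: (He i).1.
rewrite /telD /=; congr pair; apply/funext => i.
  rewrite coboundaryD Dc2 (Hc i).2; apply/funext => v; exact: addr0.
apply/funext => v; rewrite coboundaryN (He i).2 opprK.
have -> : pullback (N i) (acs_refine D i) (fun v => c i.+1 v + c2 i.+1 v) v =
    q i _ (c i.+1) v + q i _ (c2 i.+1) v.
  by rewrite /q /pullback; case: ifP => // _; rewrite addr0.
have := Sc2 i v; rewrite /b'; lra.
Qed.

End Vanishing.

(** * Non-vanishing in degree 2 *)

Lemma finite_set_bound (T : choiceType) (S : realDomainType) (B : set T) (f : T -> S) :
  finite_set B -> exists M, forall x, B x -> f x <= M.
Proof.
move=> /finite_seqP[s ->]; elim: s => [|x s [M HM]]; first by exists 0.
exists (Num.max (f x) M) => y /=; rewrite inE le_max => /predU1P[->|ys].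
  by rewrite lexx.
by rewrite HM ?orbT.
Qed.

Section Pairs.
Context {V : choiceType}.

Lemma ord2P (i : 'I_2) : i = ord0 \/ i = ord_max.
Proof. by case: i => [[|[|]]] // h; [left|right]; apply: val_inj. Qed.

(** Edges are built with [fcons] so that the cone formula computes their face sums. *)
Definition pair2 (x y : V) : 'I_2 -> V := fcons x (fun _ : 'I_1 => y).

Lemma pair2_0 x y : pair2 x y ord0 = x.
Proof. exact: fcons0. Qed.

Lemma pair2_max x y : pair2 x y ord_max = y.
Proof.
by rewrite /pair2 (_ : ord_max = lift ord0 ord0) ?fcons_lift //; apply: val_inj.
Qed.

Lemma face_sum_pair2 (z : cochain V 1) x y :
  face_sum z (pair2 x y) = z (fun=> y) - z (fun=> x).
Proof.
rewrite face_sum_fcons big_ord1 expr0 mul1r; congr (_ - z _); apply/funext => j.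
by rewrite [j]ord1 fcons0.
Qed.

Lemma face_sum_triple (z : cochain V 2) x y1 y2 :
  face_sum z (fcons x (pair2 y1 y2)) =
  z (pair2 y1 y2) - (z (pair2 x y2) - z (pair2 x y1)).
Proof.
by rewrite face_sum_fcons -(face_sum_pair2 (fun v => z (fcons x v))).
Qed.

Lemma alternating2 (z : cochain V 2) :
  (forall v, v ord0 = v ord_max -> z v = 0) ->
  (forall v, z (v \o tperm ord0 ord_max) = - z v) -> alternating z.
Proof.
move=> z0 zt; split=> [v vni|v s].
  apply: z0; apply: contrapT => e; apply: vni => i j.
  by case: (ord2P i) => ->; case: (ord2P j) => -> // e'; case: e.
have [s0|s1] := ord2P (s ord0).
  have -> : s = 1%g.
    apply/permP => i; rewrite perm1; case: (ord2P i) => -> //.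
    have [e|//] := ord2P (s ord_max).
    by have /perm_inj := etrans e (esym s0).
  by rewrite odd_perm1 expr0 mul1r; congr z; apply/funext => i /=; rewrite perm1.
have -> : s = tperm ord0 ord_max.
  apply/permP => i; case: (ord2P i) => ->; first by rewrite tpermL.
  rewrite tpermR; have [//|e] := ord2P (s ord_max).
  by have /perm_inj := etrans e (esym s1).
by rewrite zt odd_tperm /= expr1 mulN1r.
Qed.

End Pairs.

Lemma pair2_comp (V W : choiceType) (f : V -> W) x y :
  f \o pair2 x y = pair2 (f x) (f y).
Proof. by apply/funext => i /=; case: (ord2P i) => ->; rewrite ?pair2_0 ?pair2_max. Qed.

(** * Long geodesics in spaces of positive asymptotic dimension *)

Section UnboundedSpaces.
Context {R : realType} {Y : metricType R}.

(** If all distances were at most [r], the single set Y would be a cover showing asdim <= 0. *)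
Lemma asdim_unbounded : ~ asdim_le (@mdist R Y) 0 ->
  forall r, exists o y : Y, r < mdist o y.
Proof.
move=> nas r; apply: contrapT => h; apply: nas => e e0.
exists r, (fun _ => [set setT]); split.
- by move=> j A B -> ->.
- by move=> j A -> x y _ _; rewrite leNgt; apply/negP => xy; apply: h; exists x, y.
- by move=> x; exists ord0, setT.
Qed.

Lemma asdim_unbounded_from : ~ asdim_le (@mdist R Y) 0 ->
  exists o : Y, forall r, exists y : Y, r < mdist o y.
Proof.
move=> nas; have [p _] := asdim_unbounded nas 0; exists p => r.
have [x [y xy]] := asdim_unbounded nas (r + r).
have [px|px] := ltP r (mdist p x); first by exists x.
exists y; have := metric_triangle x p y; rewrite (metric_sym x p); lra.
Qed.

Lemma geodesic_sequence (o : Y) : geodesic_space Y ->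
  (forall r, exists y : Y, r < mdist o y) ->
  forall n : nat, exists gam : nat -> Y, gam 0%N = o /\
    forall l l', (l <= n)%N -> (l' <= n)%N ->
      mdist (gam l) (gam l') = `|l%:R - l'%:R|.
Proof.
move=> geo unb n; have [y ny] := unb n%:R.
have [g [g0 _ gd]] := geo o y; exists (fun l => g l%:R); split => // l l' ln ln'.
have h l0 : (l0 <= n)%N -> (0 : R) <= l0%:R <= mdist o y.
  by move=> l0n; rewrite ler0n (le_trans _ (ltW ny)) // ler_nat.
by apply: gd; exact: h.
Qed.

End UnboundedSpaces.

(** * A nontrivial telescope cocycle supported near a sparse sequence *)

Section NonVanishing.
Context {R : realType} {Y : metricType R} (D : anti_cech_system Y).
Context (pY : proper_space Y).

Let N := acs_nerve D.
Let sub := acs_sub D.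

(** A vertex in the stars of two points at stage [i] puts them within three mesh lengths. Both
    neighbouring meshes enter because [a_i] must be far from earlier and later points alike. *)
Definition gap i : nat := (Num.truncn (3 * (mesh D i + mesh D i.+1))).+1.
Definition radius k : nat := \sum_(i < k) gap i.

Lemma radius_gap i j : (i < j)%N ->
  3 * mesh D i < (radius j)%:R - (radius i)%:R /\
  3 * mesh D j < (radius j)%:R - (radius i)%:R.
Proof.
have mg l : 3 * (mesh D l + mesh D l.+1) < (gap l)%:R by exact: truncnS_gt.
have radS l : radius l.+1 = (radius l + gap l)%N by rewrite /radius big_ord_recr.
have mono l d : (radius l <= radius (l + d))%N.
  elim: d => [|d IH]; first by rewrite addn0.
  by rewrite addnS radS (leq_trans IH) // leq_addr.
move=> ij; split.
  rewrite -(subnKC ij); have := mono i.+1 (j - i.+1)%N.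
  move: (radius (_ + _)) => r; rewrite radS -(ler_nat R) natrD => h.
  have := mg i; have := mesh_ge0 D i.+1; lra.
case: j ij => // j; rewrite ltnS => ij.
have := mono i (j - i)%N; rewrite subnKC // radS natrD -(ler_nat R) => h.
have := mg j; have := mesh_ge0 D j; lra.
Qed.

Section SparsePoints.
Context (a : nat -> Y)
  (far : forall i j, i != j -> 3 * mesh D i < mdist (a i) (a j)).

Definition height i (u : set Y) : int :=
  if `[< common_star D i (a i) [set u] >] then i%:Z else 0.

(** The coboundary of [height i]. For i > 0 the function [height i] is nonzero on A_i, so it is not
    itself a relative cochain. *)
Definition spike i : cochain (set Y) 2 :=
  fun v => if `[< N i (vset v) >] then height i (v ord_max) - height i (v ord0) else 0.

(** Sparsity separates the stars of different points, so the height is constant on the star of each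
    point of the sequence; hence [spike] vanishes on A_i. *)
Lemma heightE i j u : acs_cover D i u -> common_star D i (a j) [set u] ->
  height i u = if i == j then i%:Z else 0.
Proof.
move=> Uu [y [uy jy]]; rewrite /height; case: eqVneq => [eij|/far].
  by rewrite -eij in jy; rewrite asboolT //; exists y.
case: asboolP => // -[y' [uy' iy']]; rewrite ltNge => /negP; case.
have [v Uv va] := acs_coverT D i (a i); have [w Uw wa] := acs_coverT D i (a j).
have h1 := meshE Uv va (iy' v Uv va); have h2 := meshE Uw wa (jy w Uw wa).
have h3 := meshE Uu (uy' u erefl) (uy u erefl).
have := metric_triangle (a i) y' (a j); have := metric_triangle y' y (a j).
rewrite (metric_sym y (a j)); lra.
Qed.

Lemma spike_ccochains i : ccochains (N i) (sub [set a k | k in setT] i) (spike i).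
Proof.
have alt : alternating (spike i).
  apply: alternating2 => v; rewrite /spike.
    by move=> ->; rewrite subrr; case: ifP.
  rewrite vset_perm /= tpermL tpermR; case: ifP => _; last by rewrite oppr0.
  by rewrite opprB.
split; last 2 first.
- exact: alt.2.
- pose F := [set u | acs_cover D i u /\
    exists2 x, u x & mdist (a i) x <= mesh D i + mesh D i].
  have Ff : finite_set F by exact: cover_near_finite.
  apply: sub_finite_set (finite_tuples 2 Ff) => v /=; rewrite /spike.
  case: ifP => // /asboolP [_ Nv [x vx]] hv l.
  have vl j : v j \in vset v by apply/vsetP; exists j.
  split; first exact: Nv.
  exists x; first exact: vx.
  have [j sj] : exists j, common_star D i (a i) [set v j].
    apply: contrapT => H; apply: hv; rewrite /height.
    case: asboolP => h1; first by case: H; exists ord_max.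
    by case: asboolP => h2; first by case: H; exists ord0.
  have [y [vy iy]] := sj; have [w Uw wa] := acs_coverT D i (a i).
  apply: le_trans (metric_triangle _ y _) _; apply: lerD.
    exact: meshE Uw wa (iy w Uw wa).
  by apply: meshE (Nv _ (vl j)) (vy _ erefl) _; exact: vx.
- move=> v hv; split.
  + by apply: contrapT => vni; apply: hv; exact: alt.1.
  + by move: hv; rewrite /spike; case: ifP => // /asboolP.
  + move=> /acs_subP[Nv [_ [j _ <-] [y [vy jy]]]]; apply: hv; rewrite /spike.
    case: ifP => // _; have [_ Uv _] := Nv.
    have H l : height i (v l) = if i == j then i%:Z else 0.
      have vl : v l \in vset v by apply/vsetP; exists l.
      by apply: heightE; [exact: Uv|exists y; split => // u ->; exact: vy].
    by rewrite !H subrr.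
Qed.

Lemma spike_cocycle i : coboundary (N i) (spike i) = (fun=> 0).
Proof.
apply/funext => v; rewrite coboundaryE; case: asboolP => // Nv.
have Nl l : `[< N i (vset (v \o lift l)) >].
  apply/asboolP; apply: (@nerve_face_closed _ _ D i _ _ Nv); first exact: vset_neq0.
  by apply/fsubsetP => y /vsetP[m ->]; apply/vsetP; exists (lift l m).
rewrite /face_sum !big_ord_recl big_ord0 /spike !Nl /=.
set x0 := ord0; set x1 : 'I_3 := lift ord0 ord0; set x2 : 'I_3 := ord_max.
have -> : lift ord0 ord_max = x2 :> 'I_3 by apply: val_inj.
have -> : lift x1 ord_max = x2 :> 'I_3 by apply: val_inj.
have -> : lift x1 ord0 = x0 :> 'I_3 by apply: val_inj.
have -> : lift (lift ord0 (lift ord0 ord0)) ord_max = x1 :> 'I_3 by apply: val_inj.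
have -> : lift (lift ord0 (lift ord0 ord0)) ord0 = x0 :> 'I_3 by apply: val_inj.
rewrite /bump /= !expr0 expr1 expr2; lra.
Qed.

End SparsePoints.

Lemma sum_indicator_le (M : int) B n (h : nat -> int) : 0 <= M ->
  (forall l, `|h l| <= if (l < B)%N then M else 0) ->
  `|\sum_(0 <= l < n) h l| <= B%:Z * M.
Proof.
move=> M0 hM; apply: (@le_trans _ _ ((minn n B)%:Z * M)); last first.
  by apply: ler_wpM2r => //; rewrite lez_nat geq_minr.
elim: n => [|n IH]; first by rewrite big_geq // normr0 min0n mul0r.
rewrite big_nat_recr //=; apply: le_trans (ler_normD _ _) _.
have := hM n; case: ltnP => nB hn.
  rewrite (minn_idPl nB); rewrite (minn_idPl (ltnW nB)) in IH.
  by rewrite -addn1 PoszD mulrDl mul1r; exact: lerD.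
rewrite (minn_idPr nB) in IH; rewrite (minn_idPr (leqW nB)).
by rewrite -[X in _ <= X]addr0; exact: lerD.
Qed.

Lemma acs_sub_vset A k j (v : 'I_j.+1 -> set Y) : A (k : Y) ->
  forall i, (forall l, acs_cover D i (v l)) -> (forall l, v l k) ->
  sub A i (vset v).
Proof.
move=> Ak i Uv vk; apply/acs_subP; split.
  split; first exact: vset_neq0.
    by move=> u /vsetP[l ->].
  by exists k => u /vsetP[l ->].
by exists k => //; exists k; split => // u /vsetP[l ->].
Qed.

Lemma nerve_vset i j (v : 'I_j.+1 -> set Y) y :
  (forall l, acs_cover D i (v l)) -> (forall l, v l y) -> N i (vset v).
Proof.
move=> Uv vy; split; first exact: vset_neq0.
  by move=> u /vsetP[l ->].
by exists y => u /vsetP[l ->].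
Qed.

Lemma HX2_neq0 : geodesic_space Y -> ~ asdim_le (@mdist R Y) 0 ->
  exists A, HX_neq0 D A 2.
Proof.
move=> geo nas; have [p unb] := asdim_unbounded_from nas.
have /choice[gam Hgam] := fun k => geodesic_sequence geo unb (radius k).
have gam0 k : gam k 0%N = p by have [] := Hgam k.
have gamd k l l' : (l <= radius k)%N -> (l' <= radius k)%N ->
    mdist (gam k l) (gam k l') = `|l%:R - l'%:R|.
  by have [_] := Hgam k; apply.
have gamp k l : (l <= radius k)%N -> mdist p (gam k l) = l%:R.
  by move=> lk; rewrite -(gam0 k) gamd // sub0r normrN normr_nat.
pose a k := gam k (radius k).
have a0 : a 0%N = p by rewrite /a /radius big_ord0 gam0.
have ap k : mdist p (a k) = (radius k)%:R by exact: gamp.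
have far i j : i != j -> 3 * mesh D i < mdist (a i) (a j).
  have t1 := metric_triangle p (a i) (a j); have t2 := metric_triangle p (a j) (a i).
  rewrite (metric_sym (a j)) in t2; rewrite !ap in t1 t2.
  by rewrite neq_ltn => /orP[/radius_gap[h1 h2]|/radius_gap[h1 h2]]; lra.
pose A := [set a k | k in setT]; exists A.
pose z : tel (Y := Y) 2 := (fun _ _ => 0, spike a).
exists z; split.
  split; first by move=> i; split; [exact: ccochains0|exact: spike_ccochains].
  rewrite /telD /tel0 /=; congr pair; apply/funext => i; first exact: coboundary0.
  rewrite spike_cocycle; apply/funext => v; rewrite !subr0 /pullback.
  by case: ifP.
move=> [[c e] Cce Dce].
have Cc i : ccochains (N i) (sub A i) (c i) by have [] := Cce i.
have Ce i : ccochains (N i) (sub A i) (e i) by have [] := Cce i.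
have dc i : coboundary (N i) (c i) = (fun=> 0).
  exact: (congr1 (fun w => w.1 i) Dce).
have de i v : pullback (N i) (acs_refine D i) (c i.+1) v - c i v
    - coboundary (N i) (e i) v = spike a i v.
  exact: (congr1 (fun w => w.2 i v) Dce).
(* From this stage on unit balls lie in members, so consecutive points of a geodesic give an edge of
   the nerve. *)
have [i0 Hi0] := Lebesgue_large D (ler01 : 0 <= 1 :> R).
have /choice[Vb HVb] : forall x, exists u, acs_cover D i0 u /\
    forall y, mdist x y <= 1 -> u y.
  by move=> x; have [u] := Hi0 i0 (leqnn _) x; exists u.
(* Choosing vertices at stage [i0] only and refining them makes the paths at successive stages
   correspond under q. *)
pose P d k l := refine D d i0 (Vb (gam k l)).
have PU d k l : acs_cover D (d + i0) (P d k l).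
  by have [] := @refineP _ _ D d i0 _ (HVb (gam k l)).1.
have Vb1 d k l y : mdist (gam k l) y <= 1 -> P d k l y.
  have [_ h] := @refineP _ _ D d i0 _ (HVb (gam k l)).1.
  by move=> ly; apply: h; apply: (HVb _).2.
have P0 d k l : P d k l (gam k l) by apply: Vb1; rewrite mdistxx ler01.
have P1 d k l : (l < radius k)%N -> P d k l (gam k l.+1).
  move=> lk; apply: Vb1; rewrite gamd // ?(ltnW lk) // -natr1.
  by rewrite opprD addrA subrr sub0r normrN normr1.
have c0A d k : e (d + i0)%N (fun=> P d k 0%N) = 0.
  have [+ _ _] := Ce (d + i0)%N; move=> /(_ (fun=> P d k 0%N)) H.
  apply: contrapT => /H[_ _]; apply; apply: (@acs_sub_vset _ (a 0%N)); first by exists 0%N.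
    by move=> l; exact: PU.
  by move=> l; rewrite a0 -(gam0 k).
have cTA d k : e (d + i0)%N (fun=> P d k (radius k)) = 0.
  have [+ _ _] := Ce (d + i0)%N; move=> /(_ (fun=> P d k (radius k))) H.
  apply: contrapT => /H[_ _]; apply; apply: (@acs_sub_vset _ (a k)); first by exists k.
    by move=> l; exact: PU.
  by move=> l; exact: P0.
(* The integral of c at stage [d + i0] along the path from a_0 to a_k. *)
pose H d k := \sum_(0 <= l < radius k) c (d + i0)%N (pair2 (P d k l) (P d k l.+1)).
have NP d k l : (l < radius k)%N -> N (d + i0) (vset (pair2 (P d k l) (P d k l.+1))).
  move=> lk; apply: (@nerve_vset _ _ _ (gam k l.+1)) => q;
    case: (ord2P q) => ->; rewrite ?pair2_0 ?pair2_max //.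
  exact: P1.
(* The telescope equation, summed over the path, leaves boundary terms; those of [e] vanish because
   both ends lie in [A], and the height survives only at a_k for stage k. *)
have HS d k : H d.+1 k = H d k + (if (d + i0)%N == k then k%:Z else 0).
  pose i := (d + i0)%N.
  have : H d.+1 k - H d k = \sum_(0 <= l < radius k)
      ((e i (fun=> P d k l.+1) + height a i (P d k l.+1)) -
       (e i (fun=> P d k l) + height a i (P d k l))).
    rewrite -sumrB; apply: eq_big_nat => l /= lk.
    have := de i (pair2 (P d k l) (P d k l.+1)).
    rewrite coboundaryE /pullback /spike asboolT; last exact: NP.
    rewrite face_sum_pair2 pair2_0 pair2_max pair2_comp => E.
    rewrite -[c (d.+1 + i0)%N _]/(c i.+1 (pair2 (acs_refine D i (P d k l))
      (acs_refine D i (P d k l.+1)))).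
    move: E; rewrite -/i; lra.
  rewrite telescope_sumr // c0A cTA.
  have -> : height a i (P d k (radius k)) = if i == k then i%:Z else 0.
    by apply: (heightE far (PU _ _ _)); exists (a k); split => // u ->; exact: P0.
  (* At a_0 the height is nonzero at most for [i = 0], where its value is 0 anyway. *)
  have -> : height a i (P d k 0%N) = 0.
    rewrite (@heightE a far i 0%N _ (PU _ _ _)); first by case: eqP => // ->.
    by exists (a 0%N); split => // u ->; rewrite a0 -(gam0 k).
  rewrite -/i !add0r subr0 => /eqP; rewrite subr_eq addrC => /eqP ->.
  by case: eqVneq => [->|].
have HE d k : (i0 <= k)%N ->
    H d k = H 0%N k + (if (k < d + i0)%N then k%:Z else 0).
  move=> ik; elim: d => [|d IH]; first by rewrite add0n ltnNge ik addr0.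
  rewrite HS IH -addrA; congr (_ + _).
  rewrite addSn ltnS [in RHS]leq_eqVlt [k == _]eq_sym.
  by case: eqVneq => [->|_] /=; rewrite ?ltnn /= ?add0r ?addr0.
(* At a late stage one member [u] contains the whole geodesic. Coning from [u] turns the integral of
   the cocycle into a difference of end values, and these vanish since the ends lie in [A]. *)
have Hlarge k : exists2 d, (k < d + i0)%N & H d k = 0.
  have [j0 Hj0] := Lebesgue_large D (ler0n R (radius k)).
  exists (maxn j0 k.+1); first by rewrite ltn_addr // leq_max leqnn orbT.
  set d := maxn j0 k.+1.
  have /Hj0 /(_ p) [u Uu up] : (j0 <= d + i0)%N.
    exact: leq_trans (leq_maxl _ _) (leq_addr _ _).
  have cp x : mdist p x <= (radius k)%:R -> u x by exact: up.
  pose f l := c (d + i0)%N (pair2 u (P d k l)).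
  have f0 l x : A x -> u x -> P d k l x -> f l = 0.
    move=> Ax ux Px; have [+ _ _] := Cc (d + i0)%N.
    move=> /(_ (pair2 u (P d k l))) h.
    apply: contrapT => /h[_ _]; apply; apply: (acs_sub_vset Ax) => q;
      by case: (ord2P q) => ->; rewrite ?pair2_0 ?pair2_max.
  have -> : H d k = \sum_(0 <= l < radius k) (f l.+1 - f l).
    apply: eq_big_nat => l /= lk.
    have : coboundary (N (d + i0)%N) (c (d + i0)%N)
        (fcons u (pair2 (P d k l) (P d k l.+1))) = 0 by rewrite dc.
    rewrite coboundaryE asboolT.
      by rewrite face_sum_triple => /eqP; rewrite subr_eq0 => /eqP.
    apply: (@nerve_vset _ _ _ (gam k l.+1)) => q; case: (unliftP ord0 q) => [q' ->|->];
      rewrite ?fcons_lift ?fcons0 //.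
    - by case: (ord2P q') => ->; rewrite ?pair2_0 ?pair2_max.
    - by case: (ord2P q') => ->; rewrite ?pair2_0 ?pair2_max //; exact: P1.
    - by apply: cp; rewrite gamp // ler_nat.
  rewrite telescope_sumr // (f0 _ (a k)) ?(f0 _ p) ?subrr //.
  - by exists 0%N.
  - by apply: cp; rewrite mdistxx ler0n.
  - by rewrite -(gam0 k).
  - by exists k.
  - by apply: cp; rewrite ap.
have Hk k : (i0 <= k)%N -> H 0%N k = - k%:Z.
  move=> ik; have [d kd Hd] := Hlarge k; have := HE d k ik.
  by rewrite Hd kd => /eqP; rewrite eq_sym addr_eq0 => /eqP.
(* A bound independent of k: [c i0] takes values of size at most [M], and since [gam k l] is at
   distance [l] from [p], only edges with [l < B] meet its support. *)
have [M0 HM0] := finite_set_bound (fun v => `|c i0 v|)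
  (let: And3 _ _ h := Cc i0 in h).
pose M := Num.max 0 M0.
have HM v : `|c i0 v| <= M.
  have [/eqP ->|/eqP/HM0 cM] := boolP (c i0 v == 0).
    by rewrite normr0 le_max lexx.
  by rewrite le_max cM orbT.
have /choice[rad Hrad] : forall v, exists r : R, acs_cover D i0 v ->
    forall x, v x -> mdist p x <= r.
  move=> v; have [[x vx]|nv] := pselect (exists x, v x).
    exists (mdist p x + mesh D i0) => Uv y vy.
    by apply: le_trans (metric_triangle _ x _) _; rewrite lerD2l; exact: meshE Uv vx vy.
  by exists 0 => _ x vx; case: nv; exists x.
have [B0 HB0] := finite_set_bound rad (support_vertices_finite (Cc i0)).
pose B := (Num.truncn B0).+1.
have Hbound k : `|H 0%N k| <= B%:Z * M.
  rewrite /H big_nat_cond big_mkcond /=.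
  apply: sum_indicator_le => [|l]; first by rewrite le_max lexx.
  case: ifP => [/andP[lk _]|_]; last first.
    by rewrite normr0; case: ifP => // _; rewrite le_max lexx.
  case: ltnP => lB; first exact: HM.
  rewrite normr_le0; apply/eqP; apply: contrapT => cn.
  have Pl : support_vertices (c i0) (P 0%N k l).
    by exists (pair2 (P 0%N k l) (P 0%N k l.+1)), ord0; rewrite pair2_0.
  have := Hrad _ (PU 0%N k l) _ (P0 0%N k l); rewrite gamp ?(ltnW lk) // => lr.
  have := le_trans lr (HB0 _ Pl); apply/negP; rewrite -ltNge.
  by apply: lt_le_trans (truncnS_gt _) _; rewrite ler_nat.
(* Large enough both for the jump to occur at a stage past [i0] and for [K] to exceed the bound. *)
pose K := (i0 + absz (B%:Z * M)).+1.
have := Hbound K; rewrite Hk ?normrN; last by rewrite /K -addnS leq_addr.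
apply/negP; rewrite -ltNge.
have : 0 <= B%:Z * M by rewrite mulr_ge0 // le_max lexx.
move=> /gez0_abs <-; rewrite /K; lia.
Qed.

End NonVanishing.

(** * The coarse cohomological dimension *)

Theorem corollary5p4 (R : realType) (Y : metricType R)
    (Y_proper : proper_space Y) (Y_geodesic : geodesic_space Y)
    (Y_bounded_geometry : bounded_geometry Y)
    (asdim_Y : is_asdim (@mdist R Y) 2)
    (asdim_YR : is_asdim (@l1_dist R Y) 2)
    (D : anti_cech_system Y) :
  is_Xdim D 1.
Proof.
(* Minimality of 2 rules out asdim <= 0, which makes Y unbounded and in particular nonempty. *)
have nas : ~ asdim_le (@mdist R Y) 0 by move=> /(asdim_Y.2 0%N).
have [y0 _] := asdim_unbounded nas 0.
exists 2%N; split => //; first exact: HX2_neq0.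
move=> [|[|[|j]]] // [A]; have := @HX_vanish _ _ D Y_proper y0 asdim_YR.1 A j.
by [].
Qed.
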